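(* Consider the mathematical program with switching constraints (MPSC) $$\min f(z)\quad\text{s.t.}\quad g(z)\le 0,\ h(z)=0,\ G_i(z)H_i(z)=0,\ i=1,\dots,m.$$ (A) Let $z^*$ be a local minimizer of MPSC and let $d\in\mathcal C_{\mathcal F}(z^* )$. (A1) If MPSC-LICQ($d$) holds at $z^*$, then $z^*$ is an S-stationary point in direction $d$. (A2) If MPSC quasi-normality holds at $z^*$ in direction $d$, then $z^*$ is an M-stationary point in direction $d$; if moreover $f,g,h,G,H$ are twice differentiable at $z^*$, then there exists an M-multiplier in direction $d$, $(\lambda^g,\lambda^h,\lambda^G,\lambda^H)$, such that $$d^T\nabla_z^2\mathcal L(z^*,\lambda^g,\lambda^h,\lambda^G,\lambda^H)d\ge0.$$ (B) Conversely, suppose $z^*$ is a feasible solution of MPSC, that $f,g,h,G,H$ are twice differentiable at $z^*$, and that for each $0\ne d\in\mathcal C_{\mathcal F}(z^* )$ there is an S-multiplier $(\lambda^g,\lambda^h,\lambda^G,\lambda^H)$ such that $$d^T\nabla_z^2\mathcal L(z^*,\lambda^g,\lambda^h,\lambda^G,\lambda^H)d>0.$$ Then $z^*$ is a strict local minimizer of MPSC.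
   Context: Setting: $f:\mathbb R^n\to\mathbb R$, $g:\mathbb R^n\to\mathbb R^p$, $h:\mathbb R^n\to\mathbb R^q$, $G=(G_1,\dots,G_m)$, $H=(H_1,\dots,H_m):\mathbb R^n\to\mathbb R^m$ are continuously differentiable; gradients are column vectors. $\mathcal F$ is the feasible region. The Lagrangian is $$\mathcal L(z,\lambda^g,\lambda^h,\lambda^G,\lambda^H)=f(z)+\langle\lambda^g,g(z)\rangle+\langle\lambda^h,h(z)\rangle+\langle\lambda^G,G(z)\rangle+\langle\lambda^H,H(z)\rangle.$$ Index sets at $z^*\in\mathcal F$: $\mathcal I_g^*=\{i: g_i(z^* )=0\}$; $\mathcal I_G^*=\{i: G_i(z^* )=0,H_i(z^* )\ne0\}$; $\mathcal I_H^*=\{i: G_i(z^* )\neq0,H_i(z^* )=0\}$; $\mathcal I_{GH}^*=\{i: G_i(z^* )=H_i(z^* )=0\}$. Linearization cone $L_{\mathcal F}^{\rm lin}(z^* )$: all $d\in\mathbb R^n$ with $\nabla g_i(z^* )^Td\le0$ ($i\in\mathcal I_g^*$), $\nabla h_j(z^* )^Td=0$ ($j=1,\dots,q$), $\nabla G_i(z^* )^Td=0$ ($i\in\mathcal I_G^*$), $\nabla H_i(z^* )^Td=0$ ($i\in\mathcal I_H^*$), $(\nabla G_i(z^* )^Td)(\nabla H_i(z^* )^Td)=0$ ($i\in\mathcal I_{GH}^*$). Critical cone: $\mathcal C_{\mathcal F}(z^* )=\{d\in L_{\mathcal F}^{\rm lin}(z^* ): \nabla f(z^* )^Td\le0\}$.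 For $d\in L_{\mathcal F}^{\rm lin}(z^* )$: $\mathcal I_g^*(d)=\{i\in\mathcal I_g^*:\nabla g_i(z^* )^Td=0\}$; $\mathcal I_G^*(d)=\{i\in\mathcal I_{GH}^*:\nabla G_i(z^* )^Td=0,\nabla H_i(z^* )^Td\ne0\}$; $\mathcal I_H^*(d)=\{i\in\mathcal I_{GH}^*:\nabla G_i(z^* )^Td\ne0,\nabla H_i(z^* )^Td=0\}$; $\mathcal I_{GH}^*(d)=\{i\in\mathcal I_{GH}^*:\nabla G_i(z^* )^Td=\nabla H_i(z^* )^Td=0\}$. MPSC-LICQ($d$) holds at $z^*$ if the family of gradients $\nabla g_i(z^* )$ ($i\in\mathcal I_g^*(d)$), $\nabla h_j(z^* )$ ($j=1,\dots,q$), $\nabla G_i(z^* )$ ($i\in\mathcal I_G^*\cup\mathcal I_G^*(d)\cup\mathcal I_{GH}^*(d)$), $\nabla H_i(z^* )$ ($i\in\mathcal I_H^*\cup\mathcal I_H^*(d)\cup\mathcal I_{GH}^*(d)$) is linearly independent. MPSC quasi-normality in direction $d\in L_{\mathcal F}^{\rm lin}(z^* )$ holds at $z^*$ if there is no $(\lambda^g,\lambda^h,\lambda^G,\lambda^H)\ne0$ such that: (i) $0=\nabla g(z^* )^T\lambda^g+\nabla h(z^* )^T\lambda^h+\nabla G(z^* )^T\lambda^G+\nabla H(z^* )^T\lambda^H$ ($\nabla$ of a vector-valued map denoting the Jacobian); (ii) $\lambda_i^g\ge0$ for $i\in\mathcal I_g^*(d)$, $\lambda_i^g=0$ for $i\notin\mathcal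 I_g^*(d)$, $\lambda_i^H=0$ for $i\in\mathcal I_G^*\cup\mathcal I_G^*(d)$, $\lambda_i^G=0$ for $i\in\mathcal I_H^*\cup\mathcal I_H^*(d)$, $\lambda_i^G\lambda_i^H=0$ for $i\in\mathcal I_{GH}^*(d)$; (iii) there are sequences $d^k\to d$ and $t_k\downarrow0$ such that for all $k$: $\lambda_i^gg_i(z^*+t_kd^k)>0$ if $\lambda_i^g\ne0$, $\lambda_i^hh_i(z^*+t_kd^k)>0$ if $\lambda_i^h\ne0$, $\lambda_i^GG_i(z^*+t_kd^k)>0$ if $\lambda_i^G\neq0$, $\lambda_i^HH_i(z^*+t_kd^k)>0$ if $\lambda_i^H\ne0$. Directional stationarity, $d\in\mathcal C_{\mathcal F}(z^* )$: consider multipliers $(\lambda^g,\lambda^h,\lambda^G,\lambda^H)$ with $$0=\nabla f(z^* )+\sum_{i\in\mathcal I_g^*(d)}\lambda_i^g\nabla g_i(z^* )+\sum_{i=1}^q\lambda_i^h\nabla h_i(z^* )+\sum_{i=1}^m(\lambda_i^G\nabla G_i(z^* )+\lambda_i^H\nabla H_i(z^* )),$$ $\lambda_i^g\ge0$ for $i\in\mathcal I_g^*(d)$ (and $\lambda_i^g=0$ for $i\notin\mathcal I_g^*(d)$), $\lambda_i^G=0$ for $i\in\mathcal I_H^*\cup\mathcal I_H^*(d)$, $\lambda_i^H=0$ for $i\in\mathcal I_G^*\cup\mathcal I_G^*(d)$. The point $z^*$ is M-stationary in direction $d$ if such a multiplier exists with $\lambda_i^G\lambda_i^H=0$ for $i\in\mathcal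 I_{GH}^*(d)$ (such a multiplier is called an M-multiplier in direction $d$); it is S-stationary in direction $d$ if such a multiplier exists with $\lambda_i^G=\lambda_i^H=0$ for $i\in\mathcal I_{GH}^*(d)$. S-multiplier (non-directional): $(\lambda^g,\lambda^h,\lambda^G,\lambda^H)$ with $$\nabla f(z^* )+\sum_{i\in\mathcal I_g^*}\lambda^g_i\nabla g_i(z^* )+\sum_{i=1}^q\lambda^h_i\nabla h_i(z^* )+\sum_{i=1}^m(\lambda^G_i\nabla G_i(z^* )+\lambda^H_i\nabla H_i(z^* ))=0,$$ $\lambda_i^g\ge0$ for $i\in\mathcal I_g^*$ (and $\lambda_i^g=0$ for $i\notin\mathcal I_g^*$), $\lambda_i^G=0$ for $i\in\mathcal I_H^*$, $\lambda_i^H=0$ for $i\in\mathcal I_G^*$, $\lambda_i^G=\lambda_i^H=0$ for $i\in\mathcal I_{GH}^*$. *)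

(* Defs.v *)
From mathcomp Require Import all_boot all_order all_algebra.
From mathcomp Require Import all_classical all_reals all_analysis.

Set Implicit Arguments.
Unset Strict Implicit.
Unset Printing Implicit Defensive.

Import Order.TTheory GRing.Theory Num.Theory.
Import numFieldNormedType.Exports.

Local Open Scope ring_scope.

(* Points of R^n, directions, gradients and multipliers are column vectors. *)

Section Calculus.
Variables (R : realType) (n : nat).

Definition dotc k (u v : 'cV[R]_k) : R := \sum_(i < k) u i 0 * v i 0.

Definition component k (F : 'cV[R]_n -> 'cV[R]_k) (i : 'I_k) : 'cV[R]_n -> R :=
  fun z => F z i 0.

Definition grad (phi : 'cV[R]_n -> R) (z : 'cV[R]_n) : 'cV[R]_n :=
  \col_j 'D_(delta_mx j 0) phi z.

(* Unlike the library's ['J], which acts on row vectors from the right, this is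
   the usual k x n Jacobian: row i is the transposed gradient of component i. *)
Definition jac k (F : 'cV[R]_n -> 'cV[R]_k) (z : 'cV[R]_n) : 'M[R]_(k, n) :=
  \matrix_(i, j) grad (component F i) z j 0.

Definition hess (phi : 'cV[R]_n -> R) (z : 'cV[R]_n) : 'M[R]_n :=
  jac (grad phi) z.

Definition quad (A : 'M[R]_n) (d : 'cV[R]_n) : R := (d^T *m A *m d) 0 0.

Definition C1 (phi : 'cV[R]_n -> R) : Prop :=
  (forall z, differentiable phi z) /\ continuous (grad phi).

Definition twice_differentiable (phi : 'cV[R]_n -> R) (z : 'cV[R]_n) : Prop :=
  (\forall x \near z, differentiable phi x) /\ differentiable (grad phi) z.

End Calculus.

(* min obj  s.t.  ineq <= 0, eqc = 0, swG_i * swH_i = 0; the fields are the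
   maps f, g, h, G, H. *)
Record mpsc (R : realType) (n p q m : nat) := Mpsc {
  obj : 'cV[R]_n -> R;
  ineq : 'cV[R]_n -> 'cV[R]_p;
  eqc : 'cV[R]_n -> 'cV[R]_q;
  swG : 'cV[R]_n -> 'cV[R]_m;
  swH : 'cV[R]_n -> 'cV[R]_m }.

Section Mpsc.
Variables (R : realType) (n p q m : nat) (P : mpsc R n p q m).
Implicit Types (z d : 'cV[R]_n).
Implicit Types (lg : 'cV[R]_p) (lh : 'cV[R]_q) (lG lH : 'cV[R]_m).

Definition C1_data : Prop :=
  [/\ C1 (obj P), forall i, C1 (component (ineq P) i),
      forall i, C1 (component (eqc P) i), forall i, C1 (component (swG P) i) &
      forall i, C1 (component (swH P) i)].

Definition twice_differentiable_data z : Prop :=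
  [/\ twice_differentiable (obj P) z,
      forall i, twice_differentiable (component (ineq P) i) z,
      forall i, twice_differentiable (component (eqc P) i) z,
      forall i, twice_differentiable (component (swG P) i) z &
      forall i, twice_differentiable (component (swH P) i) z].

Definition feasible z : Prop :=
  [/\ forall i, ineq P z i 0 <= 0, forall i, eqc P z i 0 = 0 &
      forall i, swG P z i 0 * swH P z i 0 = 0].

Definition local_minimizer z : Prop :=
  feasible z /\ (\forall x \near z, feasible x -> obj P z <= obj P x).

Definition strict_local_minimizer z : Prop :=
  feasible z /\
  (\forall x \near z, feasible x -> x != z -> obj P z < obj P x).

Definition lagrangian lg lh lG lH z : R :=
  obj P z + dotc lg (ineq P z) + dotc lh (eqc P z)
  + dotc lG (swG P z) + dotc lH (swH P z).

Definition gradg z (i : 'I_p) : 'cV[R]_n := grad (component (ineq P) i) z.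
Definition gradh z (i : 'I_q) : 'cV[R]_n := grad (component (eqc P) i) z.
Definition gradG z (i : 'I_m) : 'cV[R]_n := grad (component (swG P) i) z.
Definition gradH z (i : 'I_m) : 'cV[R]_n := grad (component (swH P) i) z.

Definition Ig z : {set 'I_p} := [set i | ineq P z i 0 == 0].
Definition IG z : {set 'I_m} :=
  [set i | (swG P z i 0 == 0) && (swH P z i 0 != 0)].
Definition IH z : {set 'I_m} :=
  [set i | (swG P z i 0 != 0) && (swH P z i 0 == 0)].
Definition IGH z : {set 'I_m} :=
  [set i | (swG P z i 0 == 0) && (swH P z i 0 == 0)].

Definition lin_cone z d : Prop :=
  [/\ forall i, i \in Ig z -> dotc (gradg z i) d <= 0,
      forall i, dotc (gradh z i) d = 0,
      forall i, i \in IG z -> dotc (gradG z i) d = 0,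
      forall i, i \in IH z -> dotc (gradH z i) d = 0 &
      forall i, i \in IGH z -> dotc (gradG z i) d * dotc (gradH z i) d = 0].

Definition critical_cone z d : Prop :=
  lin_cone z d /\ dotc (grad (obj P) z) d <= 0.

Definition Ig_dir z d : {set 'I_p} :=
  [set i in Ig z | dotc (gradg z i) d == 0].
Definition IG_dir z d : {set 'I_m} :=
  [set i in IGH z | (dotc (gradG z i) d == 0) && (dotc (gradH z i) d != 0)].
Definition IH_dir z d : {set 'I_m} :=
  [set i in IGH z | (dotc (gradG z i) d != 0) && (dotc (gradH z i) d == 0)].
Definition IGH_dir z d : {set 'I_m} :=
  [set i in IGH z | (dotc (gradG z i) d == 0) && (dotc (gradH z i) d == 0)].

(* [free] on a concatenation is linear independence of the family, so a vector
   occurring twice makes it dependent. *)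
Definition LICQ_dir z d : Prop :=
  free ([seq gradg z i | i in Ig_dir z d]
        ++ [seq gradh z i | i : 'I_q]
        ++ [seq gradG z i | i in IG z :|: IG_dir z d :|: IGH_dir z d]
        ++ [seq gradH z i | i in IH z :|: IH_dir z d :|: IGH_dir z d]).

Definition pos_where_nonzero k (l : 'cV[R]_k) (F : 'cV[R]_n -> 'cV[R]_k) z :
    Prop :=
  forall i, l i 0 != 0 -> 0 < l i 0 * F z i 0.

Definition quasi_normal_seq z d lg lh lG lH : Prop :=
  exists (d_ : nat -> 'cV[R]_n) (t_ : nat -> R),
    [/\ (d_ @ \oo --> d)%classic, (t_ @ \oo --> (0 : R))%classic,
        forall k, 0 < t_ k &
        forall k, [/\ pos_where_nonzero lg (ineq P) (z + t_ k *: d_ k),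
                      pos_where_nonzero lh (eqc P) (z + t_ k *: d_ k),
                      pos_where_nonzero lG (swG P) (z + t_ k *: d_ k) &
                      pos_where_nonzero lH (swH P) (z + t_ k *: d_ k)]].

Definition multiplier_signs z d lg lG lH : Prop :=
  [/\ forall i, i \in Ig_dir z d -> 0 <= lg i 0,
      forall i, i \notin Ig_dir z d -> lg i 0 = 0,
      forall i, i \in IH z :|: IH_dir z d -> lG i 0 = 0 &
      forall i, i \in IG z :|: IG_dir z d -> lH i 0 = 0].

Definition quasi_normal_dir z d : Prop :=
  ~ exists lg lh lG lH,
    [/\ (lg, lh, lG, lH) != 0,
        0 = (jac (ineq P) z)^T *m lg + (jac (eqc P) z)^T *m lh
            + (jac (swG P) z)^T *m lG + (jac (swH P) z)^T *m lH,
        multiplier_signs z d lg lG lH,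
        forall i, i \in IGH_dir z d -> lG i 0 * lH i 0 = 0 &
        quasi_normal_seq z d lg lh lG lH].

Definition dir_multiplier z d lg lh lG lH : Prop :=
  0 = grad (obj P) z + \sum_(i in Ig_dir z d) lg i 0 *: gradg z i
      + \sum_(i < q) lh i 0 *: gradh z i
      + \sum_(i < m) (lG i 0 *: gradG z i + lH i 0 *: gradH z i)
  /\ multiplier_signs z d lg lG lH.

Definition M_multiplier_dir z d lg lh lG lH : Prop :=
  dir_multiplier z d lg lh lG lH /\
  (forall i, i \in IGH_dir z d -> lG i 0 * lH i 0 = 0).

Definition M_stationary_dir z d : Prop :=
  exists lg lh lG lH, M_multiplier_dir z d lg lh lG lH.

Definition S_stationary_dir z d : Prop :=
  exists lg lh lG lH, dir_multiplier z d lg lh lG lH /\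
    (forall i, i \in IGH_dir z d -> lG i 0 = 0 /\ lH i 0 = 0).

Definition S_multiplier z lg lh lG lH : Prop :=
  grad (obj P) z + \sum_(i in Ig z) lg i 0 *: gradg z i
    + \sum_(i < q) lh i 0 *: gradh z i
    + \sum_(i < m) (lG i 0 *: gradG z i + lH i 0 *: gradH z i) = 0
  /\ [/\ forall i, i \in Ig z -> 0 <= lg i 0,
         forall i, i \notin Ig z -> lg i 0 = 0,
         forall i, i \in IH z -> lG i 0 = 0,
         forall i, i \in IG z -> lH i 0 = 0 &
         forall i, i \in IGH z -> lG i 0 = 0 /\ lH i 0 = 0].

End Mpsc.

(* Main.v *)
Require Import Defs.
From mathcomp Require Import all_boot all_order all_algebra.
From mathcomp Require Import all_classical all_reals all_analysis.
From mathcomp Require Import ring lra.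

(* Resolving every fully degenerate switch by [G_i = 0], or every one by
   [H_i = 0], gives a nonlinear program, the branch, whose constraints (only
   those active in direction d are kept) are feasible for the MPSC along
   sequences z + t_k d_k with d_k -> d and t_k -> 0+.  Quasi-normality passes
   to the branch.  It implies metric subregularity in direction d: if
   subregularity fails, Ekeland's principle yields infeasible points
   z + t_k d_k at which the violation has almost zero slope, and the limits of
   its normalised gradients are multipliers forbidden by quasi-normality.
   Subregularity makes M * (l1 violation) an exact penalty for z in direction
   d; expanding the penalised inequality to first or second order and
   dualising the resulting piecewise linear inequality gives the
   M-multipliers.  Under LICQ the multipliers of the two branches coincide, so
   both components vanish on the degenerate switches, which is S-stationarity.
   For sufficiency, normalised differences of a sequence violating strict
   minimality converge to a critical direction along which the Hessian of the
   Lagrangian cannot be positive. *)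

Set Implicit Arguments.
Unset Strict Implicit.
Unset Printing Implicit Defensive.

Import Order.TTheory GRing.Theory Num.Theory.
Import numFieldNormedType.Exports.

Local Open Scope ring_scope.

(** * Dot product and differential calculus *)

Section DotProduct.
Variables (R : realType) (n : nat).
Implicit Types (u v w : 'cV[R]_n).

Lemma dotcE u v : dotc u v = (u^T *m v) 0 0.
Proof. by rewrite !mxE; apply: eq_bigr => i _; rewrite mxE. Qed.

Lemma dotcC u v : dotc u v = dotc v u.
Proof. by apply: eq_bigr => i _; rewrite mulrC. Qed.

Lemma dotcDr u v w : dotc u (v + w) = dotc u v + dotc u w.
Proof. by rewrite !dotcE mulmxDr mxE. Qed.

Lemma dotcZr a u v : dotc u (a *: v) = a * dotc u v.
Proof. by rewrite !dotcE -scalemxAr mxE. Qed.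

Lemma dotcNr u v : dotc u (- v) = - dotc u v.
Proof. by rewrite -scaleN1r dotcZr mulN1r. Qed.

Lemma dotcBr u v w : dotc u (v - w) = dotc u v - dotc u w.
Proof. by rewrite dotcDr dotcNr. Qed.

Lemma dotc0r u : dotc u 0 = 0.
Proof. by rewrite dotcE mulmx0 mxE. Qed.

Lemma dotcDl u v w : dotc (u + v) w = dotc u w + dotc v w.
Proof. by rewrite dotcC dotcDr !(dotcC w). Qed.

Lemma dotcZl a u v : dotc (a *: u) v = a * dotc u v.
Proof. by rewrite dotcC dotcZr dotcC. Qed.

Lemma dotcBl u v w : dotc (u - v) w = dotc u w - dotc v w.
Proof. by rewrite dotcC dotcBr !(dotcC w). Qed.

Lemma dotc0l u : dotc 0 u = 0.
Proof. by rewrite dotcC dotc0r. Qed.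

Lemma dotc_suml (I : finType) (Q : pred I) (F : I -> 'cV[R]_n) v :
  dotc (\sum_(i | Q i) F i) v = \sum_(i | Q i) dotc (F i) v.
Proof.
by apply: (big_morph (fun u => dotc u v)) => [u w|]; rewrite ?dotcDl ?dotc0l.
Qed.

Lemma dotc_inj_forall u : (forall v, dotc u v = 0) -> u = 0.
Proof.
move=> u0; apply/colP => i; rewrite mxE; have := u0 (delta_mx i 0).
rewrite /dotc (bigD1 i)//= big1 ?addr0 => [|j ji]; rewrite mxE ?eqxx.
  by rewrite mulr1.
by rewrite (negPf ji) mulr0.
Qed.

Lemma ler_norm_entry m (M : 'M[R]_(n, m)) i j : `|M i j| <= `|M|.
Proof.
rewrite [leRHS]/Num.Def.normr /= mx_normrE.
exact: (le_bigmax _ (fun ij => `|M ij.1 ij.2|) (i, j)).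
Qed.

Lemma ler_norm_dotc u v : `|dotc u v| <= n%:R * (`|u| * `|v|).
Proof.
rewrite (le_trans (ler_norm_sum _ _ _))//.
rewrite (@le_trans _ _ (\sum_(i < n) `|u| * `|v|))//.
  by apply: ler_sum => i _; rewrite normrM ler_pM// ler_norm_entry.
by rewrite sumr_const card_ord mulr_natl.
Qed.

Lemma ler_mx_norm m (M : 'M[R]_(n, m)) e :
  0 <= e -> (forall i j, `|M i j| <= e) -> `|M| <= e.
Proof.
move=> e0 Me; rewrite [leLHS]/Num.Def.normr /= mx_normrE.
by apply/bigmax_leP; split=> // -[i j] _; exact: Me.
Qed.

End DotProduct.

Lemma mx_cvgP (R : realType) m n (T : Type) (F : set_system T) {FF : Filter F}
    (M : T -> 'M[R]_(m, n)) (N : 'M[R]_(m, n)) :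
  (forall i j, M x i j @[x --> F] --> N i j)%classic -> (M @ F --> N)%classic.
Proof.
move=> MN; apply/cvgrPdist_le => e e0.
have : \forall x \near F, forall i j, `|N i j - M x i j| <= e.
  apply: filter_forall => i; apply: filter_forall => j.
  by move/cvgrPdist_le : (MN i j); exact.
apply: filterS => x H; apply: ler_mx_norm; first exact: ltW.
by move=> i j; rewrite !mxE.
Qed.

Lemma mx_cvg_entry (R : realType) m n (T : Type) (F : set_system T)
    {FF : Filter F} (M : T -> 'M[R]_(m, n)) (N : 'M[R]_(m, n)) i j :
  (M @ F --> N)%classic -> (M x i j @[x --> F] --> N i j)%classic.
Proof.
move=> MN; apply: (cvg_comp M (fun A : 'M[R]_(m, n) => A i j) MN).
exact: coord_continuous.
Qed.

Lemma cvg_sumr (R : realType) (T : Type) (F : set_system T) {FF : Filter F}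
    (I : Type) (r : seq I) (Q : pred I) (u : I -> T -> R) (a : I -> R) :
  (forall i, Q i -> (u i @ F --> a i)%classic) ->
  ((\sum_(i <- r | Q i) u i x) @[x --> F] --> \sum_(i <- r | Q i) a i)%classic.
Proof. by move=> ua; apply: cvg_big => //; exact: add_continuous. Qed.

Lemma dotc_cvg (R : realType) n (T : Type) (F : set_system T) {FF : Filter F}
    (u v : T -> 'cV[R]_n) (a b : 'cV[R]_n) :
  (u @ F --> a)%classic -> (v @ F --> b)%classic ->
  (dotc (u x) (v x) @[x --> F] --> dotc a b)%classic.
Proof.
move=> ua vb; apply: cvg_sumr => i _.
by apply: cvgM; apply: mx_cvg_entry.
Qed.

(** * First-order expansion and the mean value theorem on a line *)

Section FirstOrder.
Variables (R : realType) (n : nat).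
Implicit Types (phi : 'cV[R]_n -> R) (z v w : 'cV[R]_n).

Lemma derive_dotc phi z v :
  differentiable phi z -> 'D_v phi z = dotc (grad phi z) v.
Proof.
move=> dphi; rewrite deriveE// {1}[v]matrix_sum_delta linear_sum.
apply: eq_bigr => i _; rewrite big_ord1 linearZ mxE deriveE//.
by rewrite [RHS]mulrC.
Qed.

Lemma differentiable_first_order phi z e : differentiable phi z -> 0 < e ->
  \forall v \near (0 : 'cV[R]_n),
    `|phi (z + v) - phi z - dotc (grad phi z) v| <= e * `|v|.
Proof.
move=> dphi e0; have /diff_locallyP[_ H] := dphi.
have /eqaddoP/(_ e e0) := H; apply: filterS => v.
rewrite !fctE /= [v + z]addrC opprD addrA.
by rewrite -deriveE// derive_dotc.
Qed.

(* The quadratic correction [a s + b s^2 / 2] turns the mean value theorem into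
   a second-order expansion without integrating the gradient. *)
Lemma MVT_line phi z v a b : (forall x, differentiable phi x) ->
  exists2 s, 0 < s < 1 & phi (z + v) - phi z - a - b / 2 =
    dotc (grad phi (z + s *: v)) v - a - s * b.
Proof.
move=> dphi.
pose h s : R := phi (z + s *: v) - a * s - b / 2 * s ^+ 2.
have dphil (s : R) : is_derive s (1 : R) (fun t : R => phi (z + t *: v))
    (dotc (grad phi (z + s *: v)) v).
  have E : (fun h : R => h^-1 *: (phi (z + (h *: (1 : R) + s) *: v) -
      phi (z + s *: v))) =
      fun h => h^-1 *: (phi (h *: v + (z + s *: v)) - phi (z + s *: v)).
    apply/funext => r; congr (_ *: (phi _ - _)).
    by rewrite scalerDl [r *: (1 : R)]mulr1 addrCA.
  apply: DeriveDef.
    have := diff_derivable (v := v) (dphi (z + s *: v)).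
    by rewrite /derivable /= E.
  by rewrite -derive_dotc// /derive E.
have dh (s : R) :
    is_derive s (1 : R) h (dotc (grad phi (z + s *: v)) v - a - s * b).
  rewrite (_ : h = (fun t : R => phi (z + t *: v)) - a \*: id
     - (b / 2) \*: (id ^+ 2)); last first.
    by apply/funext => t; rewrite /h !fctE.
  apply: is_derive_eq; rewrite /= /GRing.scale/= expr1 !mulr1.
  by field.
have [|s s01 hs] := @MVT R h _ 0 1 ltr01 (fun s _ => dh s).
  apply: continuous_subspaceT => s.
  by apply: differentiable_continuous; apply/derivable1_diffP; case: (dh s).
exists s; first by rewrite in_itv in s01.
move: hs; rewrite /h scale1r scale0r addr0 subr0 mulr1 => <-.
by rewrite expr1n expr0n/=; ring.
Qed.

End FirstOrder.

(** * Second-order expansion and limits along directional sequences *)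

Section Expansions.
Variables (R : realType) (n : nat).
Implicit Types (phi : 'cV[R]_n -> R) (z v w : 'cV[R]_n).

Lemma near0P (Q : set 'cV[R]_n) :
  (\forall v \near (0 : 'cV[R]_n), Q v) <->
  exists2 e, 0 < e & forall v, `|v| < e -> Q v.
Proof.
split=> [/nbhs_ballP[e e0 eQ]|[e e0 eQ]].
  exists e => // v ve; apply: eQ.
  by rewrite -ball_normE /ball_ /= sub0r normrN.
apply/nbhs_ballP; exists e => // v.
by rewrite -ball_normE /ball_ /= sub0r normrN; exact: eQ.
Qed.

Lemma grad_first_order phi z e : differentiable (grad phi) z -> 0 < e ->
  \forall v \near (0 : 'cV[R]_n),
    `|grad phi (z + v) - grad phi z - hess phi z *m v| <= e * `|v|.
Proof.
move=> dg e0.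
have D (i : 'I_n) : \forall v \near (0 : 'cV[R]_n),
    `|grad phi (z + v) i 0 - grad phi z i 0 -
      dotc (grad (component (grad phi) i) z) v| <= e * `|v|.
  apply: (differentiable_first_order (phi := component (grad phi) i)) => //.
  exact: (differentiable_comp dg (differentiable_coord _ _ _)).
have FF := nbhs_filter (0 : 'cV[R]_n).
apply: (filterS _ (filter_forall FF D)) => v H.
apply: ler_mx_norm.
  by rewrite mulr_ge0// ltW.
move=> i j; rewrite ord1.
have -> : (grad phi (z + v) - grad phi z - hess phi z *m v) i 0 =
    grad phi (z + v) i 0 - grad phi z i 0 -
      dotc (grad (component (grad phi) i) z) v; last exact: H.
  by rewrite !mxE; congr (_ - _); apply: eq_bigr => k _; rewrite !mxE.
Qed.

Lemma quadE (A : 'M[R]_n) v : quad A v = dotc (A *m v) v.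
Proof. by rewrite /quad -mulmxA dotcC dotcE. Qed.

(** With [a] the linear term and [b] the Hessian form, [MVT_line] turns the remainder into the
    first-order remainder of the gradient at [z + s *: v], paired with [v]. Differentiability of the
    gradient at the single point [z] is therefore enough. *)
Lemma second_order phi z e : (forall x, differentiable phi x) ->
  differentiable (grad phi) z -> 0 < e ->
  \forall v \near (0 : 'cV[R]_n),
    `|phi (z + v) - phi z - dotc (grad phi z) v - quad (hess phi z) v / 2| <=
    e * `|v| ^+ 2.
Proof.
move=> dphi dg e0.
(* The factor n + 1 dominates the constant n of [ler_norm_dotc] and stays positive when n = 0. *)
have n0 : 0 < n%:R + 1 :> R by rewrite ltr_wpDl.
have /near0P[r r0 H] := grad_first_order dg (divr_gt0 e0 n0).
apply/near0P; exists r => // v vr.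
have [s /andP[s0 s1] ->] := MVT_line z v (dotc (grad phi z) v)
  (quad (hess phi z) v) dphi.
have svv : `|s *: v| <= `|v|.
  by rewrite normrZ gtr0_norm// ler_piMl// ltW.
rewrite quadE -dotcZl -!dotcBl scalemxAr (le_trans (ler_norm_dotc _ _))//.
have /(le_trans _) : e / (n%:R + 1) * `|s *: v| <= e / (n%:R + 1) * `|v|.
  by rewrite ler_wpM2l// divr_ge0// ltW.
move=> /(_ _ (H _ (le_lt_trans svv vr))) H1.
rewrite (@le_trans _ _ ((n%:R + 1) * (e / (n%:R + 1) * `|v| * `|v|)))//.
  apply: ler_pM => //; first by rewrite lerDl.
  by rewrite ler_wpM2r.
by rewrite le_eqVlt; apply/orP; left; apply/eqP; field; rewrite gt_eqF.
Qed.

Context (T : Type) (F : set_system T) {FF : Filter F}.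
Variables (t : T -> R) (w : T -> 'cV[R]_n) (w0 : 'cV[R]_n).
Hypotheses (t0 : (t @ F --> (0 : R))%classic) (t_gt0 : forall x, 0 < t x).
Hypothesis ww0 : (w @ F --> w0)%classic.

Lemma scaled_direction_cvg0 :
  (t x *: w x @[x --> F] --> (0 : 'cV[R]_n))%classic.
Proof. by rewrite -(scale0r w0); apply: cvgZ. Qed.

Lemma direction_point_cvg z : (z + t x *: w x @[x --> F] --> z)%classic.
Proof.
have := cvgD (cvg_cst z) scaled_direction_cvg0; rewrite addr0 => H; exact: H.
Qed.

Lemma direction_near_bounded : \forall x \near F, `|w x| <= `|w0| + 1.
Proof.
have /cvgrPdist_le/(_ 1 ltr01) := ww0; apply: filterS => x wx.
rewrite -[w x](subrK w0) addrC (le_trans (ler_normD _ _))// lerD2l.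
by rewrite distrC.
Qed.

(** The directions [w x] are eventually bounded, so a remainder that is o(|v|^k) is o(t^k) along
    [t x *: w x]. *)
Lemma remainder_cvg0 k (rho : 'cV[R]_n -> R) :
  (forall e, 0 < e ->
    \forall v \near (0 : 'cV[R]_n), `|rho v| <= e * `|v| ^+ k) ->
  (rho (t x *: w x) / t x ^+ k @[x --> F] --> (0 : R))%classic.
Proof.
move=> rhoo; apply/cvgr0Pnorm_le => e e0.
have c0 : 0 < (`|w0| + 1) ^+ k by rewrite exprn_gt0// ltr_wpDl.
have tw := scaled_direction_cvg0 (rhoo _ (divr_gt0 e0 c0)).
near=> x.
have tk : 0 < t x ^+ k by rewrite exprn_gt0.
rewrite normrM normfV (gtr0_norm tk) ler_pdivrMr//.
have H : `|rho (t x *: w x)| <= e / (`|w0| + 1) ^+ k * `|t x *: w x| ^+ k.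
  by near: x; exact: tw.
apply: (le_trans H); rewrite normrZ (gtr0_norm (t_gt0 x)) exprMn.
rewrite mulrCA [leRHS]mulrC ler_pM2l// mulrAC ler_pdivrMr// ler_pM2l//.
rewrite lerXn2r// ?nnegrE ?addr_ge0//.
by near: x; exact: direction_near_bounded.
Unshelve. all: by end_near. Qed.

Lemma first_order_cvg phi z : differentiable phi z ->
  ((phi (z + t x *: w x) - phi z) / t x @[x --> F] -->
    dotc (grad phi z) w0)%classic.
Proof.
move=> dphi.
pose rho v := phi (z + v) - phi z - dotc (grad phi z) v.
have H : (rho (t x *: w x) / t x ^+ 1 @[x --> F] --> (0 : R))%classic.
  by apply: remainder_cvg0 => e e0; exact: differentiable_first_order.
rewrite -[dotc _ _]add0r.
rewrite (_ : (fun x => _) = (fun x => rho (t x *: w x) / t x ^+ 1 +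
    dotc (grad phi z) (w x))).
  by apply: cvgD H _; exact: (dotc_cvg (cvg_cst _) ww0).
apply/funext => x; rewrite /rho dotcZr expr1; field.
by rewrite gt_eqF.
Qed.

(** The linear term is taken along [w x], not along its limit, so no rate of convergence of [w] to
    [w0] is needed. *)
Lemma second_order_cvg phi z : (forall x, differentiable phi x) ->
  differentiable (grad phi) z ->
  ((phi (z + t x *: w x) - phi z - t x * dotc (grad phi z) (w x)) /
     (t x ^+ 2 / 2) @[x --> F] --> quad (hess phi z) w0)%classic.
Proof.
move=> dphi dg.
pose rho v := phi (z + v) - phi z - dotc (grad phi z) v
  - quad (hess phi z) v / 2.
have H : (rho (t x *: w x) / t x ^+ 2 @[x --> F] --> (0 : R))%classic.
  by apply: remainder_cvg0 => e e0; exact: second_order.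
have Hq : (quad (hess phi z) (w x) @[x --> F] --> quad (hess phi z) w0)%classic.
  rewrite quadE; under eq_cvg do rewrite quadE.
  apply: dotc_cvg => //; apply: mx_cvgP => i j; rewrite mxE.
  under eq_cvg do rewrite mxE.
  by apply: cvg_sumr => k _; apply: cvgM; [exact: cvg_cst|exact: mx_cvg_entry].
rewrite -[quad _ w0]add0r -[0](mulr0 2).
rewrite (_ : (fun x => _) = (fun x => 2 * (rho (t x *: w x) / t x ^+ 2) +
    quad (hess phi z) (w x))).
  by apply: cvgD Hq; apply: cvgM H; exact: cvg_cst.
apply/funext => x; rewrite /rho !quadE -scalemxAr dotcZl !dotcZr; field.
by rewrite gt_eqF.
Qed.

End Expansions.

(** By [MVT_line] with both corrections zero: the intermediate point is a convex combination of [x]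
    and [y], hence stays in a ball where the gradient is bounded by [|grad phi z| + 1]. *)
Lemma C1_lipschitz (R : realType) n (phi : 'cV[R]_n -> R) z : C1 phi ->
  exists L e : R, [/\ 0 < L, 0 < e & forall x y,
    `|x - z| < e -> `|y - z| < e -> `|phi x - phi y| <= L * `|x - y|].
Proof.
move=> [dphi cg].
have /cvgrPdist_le/(_ 1 ltr01) := cg z.
move=> /nbhs_ballP[e e0 H].
exists ((n%:R + 1) * (`|grad phi z| + 1)), e; split=> //.
move=> x y xe ye.
have [s /andP[s0 s1]] := MVT_line y (x - y) 0 0 dphi.
rewrite [y + (x - y)]addrC subrK mul0r !mulr0 !subr0 => ->.
set u := y + _.
have gu : `|grad phi u| <= `|grad phi z| + 1.
  rewrite -[grad phi u](subrK (grad phi z)) addrC.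
  rewrite (le_trans (ler_normD _ _))// lerD2l distrC; apply: H.
  rewrite -ball_normE /ball_ /= distrC.
  have -> : u - z = s *: (x - z) + (1 - s) *: (y - z).
    rewrite /u scalerBl scale1r !scalerBr.
    by apply/matrixP => i j; rewrite !mxE; ring.
  rewrite (le_lt_trans (ler_normD _ _))// !normrZ.
  rewrite (gtr0_norm s0) gtr0_norm ?subr_gt0//.
  by nra.
rewrite (le_trans (ler_norm_dotc _ _))// !mulrA ler_wpM2r//.
by rewrite ler_pM// lerDl.
Qed.

Lemma differentiable_component (R : realType) n k
    (F : 'cV[R]_n -> 'cV[R]_k) z i :
  differentiable F z -> differentiable (component F i) z.
Proof.
by move=> dF; exact: (differentiable_comp dF (differentiable_coord _ _ _)).
Qed.

(** * Gradients and Hessians of linear combinations *)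

Section LinearCombination.
Variables (R : realType) (n : nat) (I : finType).
Variables (f : 'cV[R]_n -> R) (c : I -> 'cV[R]_n -> R) (l : I -> R).

Lemma grad_comb z : differentiable f z -> (forall i, differentiable (c i) z) ->
  differentiable (fun x => f x + \sum_i l i * c i x) z /\
  grad (fun x => f x + \sum_i l i * c i x) z =
    grad f z + \sum_i l i *: grad (c i) z.
Proof.
move=> df dc.
have step g h a : differentiable g z -> differentiable h z ->
    differentiable (g + a \*: h) z /\
    grad (g + a \*: h) z = grad g z + a *: grad h z.
  move=> dg dh; have dah : differentiable (a \*: h) z by exact: differentiableZ.
  split; first exact: differentiableD.
  apply/colP => j; rewrite !mxE deriveD ?deriveZ//; exact: diff_derivable.
have -> : (fun x => f x + \sum_i l i * c i x) = f + \sum_i l i \*: c i.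
  by apply/funext => x; rewrite fctE fct_sumE.
elim: (index_enum I) => [|i r [dr gr]]; first by rewrite !big_nil !addr0.
rewrite !big_cons [l i \*: c i + _]addrC [l i *: grad (c i) z + _]addrC.
rewrite !addrA -gr.
exact: step.
Qed.

End LinearCombination.

Section LinearCombinationHessian.
Variables (R : realType) (n : nat) (I : finType).
Variables (f : 'cV[R]_n -> R) (c : I -> 'cV[R]_n -> R) (l : I -> R).

Lemma quad_hess_comb z d : (forall x, differentiable f x) ->
  (forall i x, differentiable (c i) x) ->
  differentiable (grad f) z -> (forall i, differentiable (grad (c i)) z) ->
  quad (hess (fun x => f x + \sum_i l i * c i x) z) d =
    quad (hess f z) d + \sum_i l i * quad (hess (c i) z) d.
Proof.
move=> df dc dgf dgc.
have -> : hess (fun x => f x + \sum_i l i * c i x) z =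
    hess f z + \sum_i l i *: hess (c i) z.
  have E k : component (grad (fun x => f x + \sum_i l i * c i x)) k =
      fun x => component (grad f) k x + \sum_i l i * component (grad (c i)) k x.
    apply/funext => x; rewrite /component (grad_comb _ _ _).2//.
    by rewrite mxE summxE; congr (_ + _); apply: eq_bigr => i _; rewrite mxE.
  apply/matrixP => k j; rewrite [LHS]mxE E.
  rewrite (grad_comb _ _ _).2; [|exact: differentiable_component|].
    rewrite [LHS]mxE [RHS]mxE !summxE; congr (_ + _); first by rewrite [RHS]mxE.
    by apply: eq_bigr => i _; rewrite [LHS]mxE [RHS]mxE [in RHS]mxE.
  by move=> i; exact: differentiable_component.
rewrite quadE mulmxDl dotcDl -quadE mulmx_suml dotc_suml; congr (_ + _).
by apply: eq_bigr => i _; rewrite -scalemxAl dotcZl -quadE.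
Qed.

End LinearCombinationHessian.

(** * Multipliers of piecewise linear inequalities *)

Section Duality.
Variables (R : realType) (n : nat).
Implicit Types (v : 'cV[R]_n).

(** Each [v] with [x v > 0] bounds [l] below by [- p v / x v], and each [v] with [x v < 0] bounds it
    above by [p v / - x v]. Convexity makes every lower bound at most every upper bound, so the
    supremum of the lower bounds works. *)
Lemma convex_multiplier (p x : 'cV[R]_n -> R) (lo hi : R) : lo <= hi ->
  (forall s v1 v2, 0 <= s <= 1 ->
    p (s *: v1 + (1 - s) *: v2) <= s * p v1 + (1 - s) * p v2) ->
  (forall s v1 v2, x (s *: v1 + (1 - s) *: v2) = s * x v1 + (1 - s) * x v2) ->
  (forall v, 0 <= p v + Num.max (lo * x v) (hi * x v)) ->
  exists2 l, lo <= l <= hi & forall v, 0 <= p v + l * x v.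
Proof.
move=> lohi pconv xaff H.
(* Including [lo] makes the set nonempty and its supremum at least [lo]. *)
pose S := [set l | l = lo \/ exists2 v, 0 < x v & l = - p v / x v]%classic.
have Hlo v : x v <= 0 -> 0 <= p v + lo * x v.
  by move=> xv; have := H v; rewrite max_l// ler_wnM2r.
have Hhi v : 0 <= x v -> 0 <= p v + hi * x v.
  by move=> xv; have := H v; rewrite max_r// ler_wpM2r.
have ubS (b : R) : lo <= b -> (forall v, 0 < x v -> - p v / x v <= b) ->
    ubound S b.
  by move=> lob pb l [->//|[v xv ->]]; exact: pb.
have ubhi : ubound S hi.
  apply: ubS => // v xv; rewrite ler_pdivrMr//.
  by have := Hhi v (ltW xv); lra.
have S0 : (S !=set0)%classic by exists lo; left.
have hS : has_sup S by split=> //; exists hi.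
have Sub l : S l -> l <= sup S by move=> Sl; apply: ub_le_sup => //; exists hi.
exists (sup S).
  by rewrite Sub/=; [exact: ge_sup|left].
move=> v; have [xv|xv|xv] := ltgtP (x v) 0; last first.
- by have := Hlo v; rewrite xv lexx !mulr0; exact.
- have := Sub (- p v / x v); rewrite ler_pdivrMr// => K.
  have := K (or_intror (ex_intro2 _ _ v xv erefl)).
  by lra.
have : sup S <= p v / - x v.
  apply: ge_sup => //; apply: ubS.
    by rewrite ler_pdivlMr ?oppr_gt0//; have := Hlo v (ltW xv); lra.
  move=> v1 xv1; have dx : 0 < x v1 - x v by lra.
  (* This weight puts the convex combination of [v1] and [v] on [x = 0], where [p] is nonnegative;
     convexity of [p] then compares the two quotients. *)
  pose s := - x v / (x v1 - x v).
  have s1 : 1 - s = x v1 / (x v1 - x v) by rewrite /s; field; rewrite gt_eqF.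
  have s01 : 0 <= s <= 1.
    rewrite divr_ge0/=; [|lra|exact: ltW].
    by rewrite -subr_ge0 s1 divr_ge0 ?ltW.
  have x0 : x (s *: v1 + (1 - s) *: v) = 0.
    by rewrite xaff s1 /s; field; rewrite gt_eqF.
  have := Hlo (s *: v1 + (1 - s) *: v); rewrite x0 lexx mulr0 addr0 => /(_ isT).
  move=> /le_trans /(_ (pconv s v1 v s01)); rewrite s1 /s.
  have -> : - x v / (x v1 - x v) * p v1 + x v1 / (x v1 - x v) * p v =
     (x v1 * p v - x v * p v1) / (x v1 - x v) by field; rewrite gt_eqF.
  rewrite pmulr_lge0 ?invr_gt0// => H1.
  rewrite ler_pdivrMr// mulrAC ler_pdivlMr ?oppr_gt0//.
  by lra.
by rewrite ler_pdivlMr ?oppr_gt0//; lra.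
Qed.

(** Induction removes one maximum at a time: the other terms form a convex function,
    [convex_multiplier] replaces the maximum by a multiple of its affine argument, and this multiple
    is absorbed into [a0] and [q0]. At the end an affine function that is nonnegative everywhere
    must have zero slope. *)
Lemma piecewise_linear_multiplier (I : eqType) (r : seq I) (a0 : 'cV[R]_n)
    (q0 : R) (a : I -> 'cV[R]_n) (q lo hi : I -> R) :
  uniq r -> (forall i, lo i <= hi i) ->
  (forall v, 0 <= dotc a0 v + q0 + \sum_(i <- r)
     Num.max (lo i * (dotc (a i) v + q i)) (hi i * (dotc (a i) v + q i))) ->
  exists l : I -> R, [/\ forall i, lo i <= l i <= hi i,
    a0 + \sum_(i <- r) l i *: a i = 0 & 0 <= q0 + \sum_(i <- r) l i * q i].
Proof.
move=> + lohi; elim: r a0 q0 => [|i r IH] a0 q0 /=.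
  move=> _ H; exists lo; split; first by move=> i; rewrite lexx lohi.
    rewrite big_nil addr0; apply: dotc_inj_forall => v.
    apply/eqP/negPn/negP => a0v.
    (* At this point the affine function takes the value -1. *)
    have := H ((- (q0 + 1) / dotc a0 v) *: v).
    rewrite big_nil dotcZr addr0 mulfVK//; lra.
  by have := H 0; rewrite dotc0r !big_nil add0r !addr0.
move=> /andP[ir ur] H.
pose x v := dotc (a i) v + q i.
pose p v := dotc a0 v + q0 + \sum_(j <- r)
  Num.max (lo j * (dotc (a j) v + q j)) (hi j * (dotc (a j) v + q j)).
have xaff s v1 v2 : x (s *: v1 + (1 - s) *: v2) = s * x v1 + (1 - s) * x v2.
  by rewrite /x dotcDr !dotcZr; ring.
have pconv s v1 v2 : 0 <= s <= 1 ->
    p (s *: v1 + (1 - s) *: v2) <= s * p v1 + (1 - s) * p v2.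
  move=> /andP[s0 s1]; rewrite /p !mulrDr -!addrA.
  have -> : s * dotc a0 v1 + (s * q0 + (s * \sum_(j <- r)
     Num.max (lo j * (dotc (a j) v1 + q j)) (hi j * (dotc (a j) v1 + q j)) +
    ((1 - s) * dotc a0 v2 + ((1 - s) * q0 + (1 - s) * \sum_(j <- r)
     Num.max (lo j * (dotc (a j) v2 + q j)) (hi j * (dotc (a j) v2 + q j)))))) =
    dotc a0 (s *: v1 + (1 - s) *: v2) + (q0 + \sum_(j <- r)
     (s * Num.max (lo j * (dotc (a j) v1 + q j)) (hi j * (dotc (a j) v1 + q j)) +
     (1 - s) * Num.max (lo j * (dotc (a j) v2 + q j))
       (hi j * (dotc (a j) v2 + q j)))).
    by rewrite big_split/= -!mulr_sumr dotcDr !dotcZr; ring.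
  rewrite !lerD2l; apply: ler_sum => j _.
  have -> : dotc (a j) (s *: v1 + (1 - s) *: v2) + q j =
    s * (dotc (a j) v1 + q j) + (1 - s) * (dotc (a j) v2 + q j).
    by rewrite dotcDr !dotcZr; ring.
  have E (b X Y : R) : b * (s * X + (1 - s) * Y) =
    s * (b * X) + (1 - s) * (b * Y) by ring.
  rewrite ge_max !E.
  by rewrite !lerD// ler_wpM2l ?subr_ge0// le_max lexx ?orbT.
have H' v : 0 <= p v + Num.max (lo i * x v) (hi i * x v).
  by have := H v; rewrite big_cons /p -!addrA [X in _ + (_ + X)]addrC.
have [l lol Hl] := convex_multiplier (lohi i) pconv xaff H'.
have [||m [mb m0 mq]] := IH (a0 + l *: a i) (q0 + l * q i) => //.
  move=> v; set S := \sum_(_ <- _) _.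
  suff -> : dotc (a0 + l *: a i) v + (q0 + l * q i) + S = p v + l * x v by [].
  by rewrite /p -/S /x dotcDl dotcZl; ring.
have E j : j \in r -> (if j == i then l else m j) = m j.
  by case: eqP => // -> ; rewrite (negPf ir).
exists (fun j => if j == i then l else m j); split.
- by move=> j; case: eqP => [->|].
- rewrite big_cons eqxx addrA -[RHS]m0; congr (_ + _).
  by apply: eq_big_seq => j jr; rewrite E.
- rewrite big_cons eqxx addrA; apply: le_trans mq _; rewrite lerD2l.
  by rewrite le_eqVlt; apply/orP; left; apply/eqP/eq_big_seq => j jr; rewrite E.
Qed.

End Duality.

(** * Compactness and Ekeland's principle *)

Lemma trmx_continuous (R : realType) m n :
  continuous (trmx : 'M[R]_(m, n) -> 'M[R]_(n, m)).
Proof.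
move=> M; apply: (mx_cvgP (F := nbhs M)) => i j; rewrite mxE.
under eq_cvg do rewrite mxE.
exact: coord_continuous.
Qed.

(** Compactness is obtained for row vectors and carried to columns by the continuous map [trmx]. *)
Lemma closed_ball_compact (R : realType) n (x : 'cV[R]_n) (r : R) :
  compact [set y : 'cV[R]_n | `|y - x| <= r]%classic.
Proof.
pose K := [set y : 'rV[R]_n | `|y^T - x| <= r]%classic.
have cN : continuous (fun y : 'rV[R]_n => `|y^T - x|).
  move=> y; apply: (cvg_norm (F := nbhs y)).
  by apply: cvgB; [exact: trmx_continuous|exact: cvg_cst].
have cK : compact K.
  apply: bounded_closed_compact.
    exists (`|x| + r); split; first exact: num_real.
    move=> M xrM y Ky; apply: le_trans (ltW xrM).
    have -> : `|y| = `|y^T|.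
      apply/eqP; rewrite eq_le; apply/andP; split; apply: ler_mx_norm => // i j.
        by have := ler_norm_entry y^T j i; rewrite mxE.
      by rewrite mxE; exact: ler_norm_entry.
    rewrite -[y^T](subrK x) addrC (le_trans (ler_normD _ _))// lerD2l.
    exact: Ky.
  apply: (preimage_closed (f := fun y : 'rV[R]_n => `|y^T - x|)
    (D := [set s | s <= r]%classic)); last exact: closed_le.
  by move=> y _; exact: cN.
rewrite (_ : mkset _ = (trmx @` K)%classic).
  apply: continuous_compact => //; apply: continuous_subspaceT.
  exact: trmx_continuous.
apply/seteqP; split=> [y Ky|_ [y Ky <-]//].
by exists y^T; rewrite /K/= ?trmxK.
Qed.

Lemma cvg_harmonic_bound (R : realType) (V : normedModType R) (u : nat -> V)
    l C :
  (forall k, `|l - u k| <= C * k.+1%:R^-1) -> (u @ \oo --> l)%classic.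
Proof.
move=> ul.
have /cvgrPdist_le CH : (C * harmonic k @[k --> \oo] --> (0 : R))%classic.
  by rewrite -(mulr0 C); apply: cvgM; [exact: cvg_cst|exact: cvg_harmonic].
apply/cvgrPdist_le => e /CH; apply: filterS => k; rewrite sub0r normrN.
by move=> /(le_trans (ler_norm _)); exact: le_trans.
Qed.

(** The indices are picked near a cluster point. They need not be increasing: [k <= s k] is enough
    to carry over bounds by [k.+1%:R^-1]. *)
Lemma bounded_subseq (R : realType) n (u : nat -> 'cV[R]_n) (r : R) :
  (forall k, `|u k| <= r) ->
  exists (s : nat -> nat) (l : 'cV[R]_n), (forall k, (k <= s k)%N) /\
    (u \o s @ \oo --> l)%classic.
Proof.
move=> ur.
have [|l [_ lcl]] := @closed_ball_compact R n 0 r (u @ \oo)%classic _.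
  by exists 0%N => // k _ /=; rewrite subr0; exact: ur.
have /choice[s Hs] : forall k : nat,
    exists j, (k <= j)%N /\ `|l - u j| < k.+1%:R^-1.
  move=> k; have [_ [[j kj <-] lj]] : (u @` [set j | (k <= j)%N] `&`
      ball l k.+1%:R^-1 !=set0)%classic.
    apply: lcl; last by apply: nbhsx_ballx; rewrite invr_gt0.
    by exists k => // j kj; exists j.
  by exists j; split=> //; move: lj; rewrite -ball_normE.
exists s, l; split; first by move=> k; have [] := Hs k.
apply: (cvg_harmonic_bound (C := 1)) => k /=.
by rewrite mul1r ltW//; have [] := Hs k.
Qed.

(* Ekeland's principle; compactness of balls makes the minimiser of
   [psi + eta * |. - x|] directly available. *)
Lemma ekeland (R : realType) n (psi : 'cV[R]_n -> R) (x : 'cV[R]_n)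
    (eta : R) :
  continuous psi -> (forall y, 0 <= psi y) -> 0 < eta ->
  exists2 y, eta * `|y - x| + psi y <= psi x &
    forall u, psi y <= psi u + eta * `|u - y|.
Proof.
move=> cpsi psi0 eta0.
pose F u := psi u + eta * `|u - x|.
have cF : continuous F.
  move=> u; apply: (cvgD (F := nbhs u)); first exact: cpsi.
  apply: cvgM; first exact: cvg_cst.
  by apply: cvg_norm; apply: cvgB; [exact: cvg_id|exact: cvg_cst].
have [|y] := compact_EVT_min _ (@closed_ball_compact _ _ x (psi x / eta))
  (continuous_subspaceT cF).
  by exists x; rewrite /= subrr normr0 divr_ge0// ltW.
move=> _ Fy.
have FyE : F y <= psi x.
  apply: le_trans (Fy x _) _; last by rewrite /F subrr normr0 mulr0 addr0.
  by rewrite inE /= subrr normr0 divr_ge0// ltW.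
exists y; first by rewrite addrC.
move=> u.
have FyFu : F y <= F u.
  (* Outside the ball of radius [psi x / eta] the term [eta * |u - x|] alone exceeds [psi x], so the
     minimum over the ball is global. *)
  have [ux|ux] := leP `|u - x| (psi x / eta); first by apply: Fy; rewrite inE.
  apply: (le_trans FyE); rewrite ltW// (lt_le_trans (y := eta * `|u - x|))//.
    by rewrite mulrC -ltr_pdivrMr.
  by rewrite lerDr.
have : eta * `|u - x| <= eta * `|u - y| + eta * `|y - x|.
  by rewrite -mulrDr ler_pM2l// ler_distD.
by move: FyFu; rewrite /F; lra.
Qed.

(** * Directional exact penalty and multipliers *)

Section Program.
Variables (R : realType) (n : nat) (I : finType).
Variables (c : I -> 'cV[R]_n -> R) (A E : {set I}).
Implicit Types (z d u v w x y : 'cV[R]_n).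

(** The sign is kept on equalities, so that [residual i y / violation y] is the coefficient of
    [grad (c i) y] in the gradient of [violation] wherever the latter is positive. *)
Definition residual i y := if i \in E then c i y else Num.max (c i y) 0.

Definition violation y := Num.sqrt (\sum_(i in A) residual i y ^+ 2).

Definition satisfied y := forall i, i \in A -> residual i y = 0.

(* Sequential form of being true on a directional neighbourhood of [z] in
   direction [d]; it composes with the limit arguments without choosing radii. *)
Definition dirnear z d (Q : 'cV[R]_n -> Prop) :=
  forall (t_ : nat -> R) (w_ : nat -> 'cV[R]_n),
  (forall k : nat, 0 < t_ k) -> (t_ @ \oo --> (0 : R))%classic ->
  (w_ @ \oo --> d)%classic -> \forall k \near \oo%classic, Q (z + t_ k *: w_ k).

Definition multiplier_sign (l : I -> R) :=
  (forall i, i \notin A -> l i = 0) /\ (forall i, i \notin E -> 0 <= l i).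

Definition quasi_normal z d := ~ exists l : I -> R,
  [/\ exists i, l i != 0, multiplier_sign l,
    \sum_(i in A) l i *: grad (c i) z = 0 &
    exists (t_ : nat -> R) (w_ : nat -> 'cV[R]_n),
      [/\ forall k, 0 < t_ k, (t_ @ \oo --> (0 : R))%classic,
        (w_ @ \oo --> d)%classic &
        forall k i, l i != 0 -> 0 < l i * c i (z + t_ k *: w_ k)]].

(** * Elementary bounds on residuals and violation *)

Lemma violation_ge0 y : 0 <= violation y. Proof. exact: sqrtr_ge0. Qed.

Lemma violation_sqr y : violation y ^+ 2 = \sum_(i in A) residual i y ^+ 2.
Proof. by rewrite sqr_sqrtr// sumr_ge0// => i _; rewrite sqr_ge0. Qed.

Lemma residual_le_violation i y : i \in A -> `|residual i y| <= violation y.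
Proof.
move=> iA; rewrite -sqrtr_sqr ler_sqrt ?sumr_ge0// => [|j _]; last first.
  exact: sqr_ge0.
rewrite (bigD1 i)//= lerDl sumr_ge0// => j _; exact: sqr_ge0.
Qed.

Lemma violation0_satisfied y : violation y = 0 -> satisfied y.
Proof.
move=> y0 i iA; apply/eqP; rewrite -normr_le0 -y0.
exact: residual_le_violation.
Qed.

Lemma violation_le_sum y : violation y <= \sum_(i in A) `|residual i y|.
Proof.
have s0 (Q : pred I) : 0 <= \sum_(i | Q i) `|residual i y| by exact: sumr_ge0.
rewrite -(ger0_norm (s0 _)) -sqrtr_sqr ler_sqrt ?sqr_ge0//.
suff K r : 0 <= \sum_(i <- r | i \in A) `|residual i y| /\
    \sum_(i <- r | i \in A) residual i y ^+ 2 <=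
    (\sum_(i <- r | i \in A) `|residual i y|) ^+ 2 by exact: (K _).2.
elim: r => [|i r [S0 IH]]; first by rewrite !big_nil expr0n.
rewrite !big_cons; case: ifP => // iA; split; first exact: addr_ge0.
rewrite -real_normK ?num_real// sqrrD -addrA lerD2l (le_trans IH)// lerDr.
by rewrite mulrn_wge0// mulr_ge0.
Qed.

Lemma residual_mul i y : residual i y * c i y = residual i y ^+ 2.
Proof.
rewrite /residual; case: ifP => // _.
by case: leP => _; rewrite ?mul0r ?expr0n.
Qed.

Lemma residual_abs_le i y : `|residual i y| <= `|c i y|.
Proof.
rewrite /residual; case: ifP => // _.
by case: (leP (c i y) 0) => _; rewrite ?normr0.
Qed.

(** A quadratic upper model of the squared residual, exact on equalities; it replaces
    differentiating the square of the positive part. *)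
Lemma residual_sqr_le i u y : residual i u ^+ 2 <=
  residual i y ^+ 2 + 2 * (residual i y * (c i u - c i y)) +
  (c i u - c i y) ^+ 2.
Proof.
rewrite /residual; case: ifP => _.
  by rewrite le_eqVlt; apply/orP; left; apply/eqP; ring.
have := sqr_ge0 (c i u); have := sqr_ge0 (c i u - c i y).
by case: (leP (c i u) 0) => hu; case: (leP (c i y) 0) => hy; nra.
Qed.

(** * Metric subregularity in a direction *)

Hypothesis cC1 : forall i, C1 (c i).

Lemma c_continuous i : continuous (c i).
Proof. by move=> y; apply: differentiable_continuous; exact: (cC1 i).1. Qed.

Lemma violation_continuous : continuous violation.
Proof.
move=> y; apply: continuous_comp; last exact: sqrt_continuous.
apply: (cvg_sumr (F := nbhs y)) => i _.
have cr : (residual i u @[u --> y] --> residual i y)%classic.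
  rewrite /residual; case: ifP => _; first exact: c_continuous.
  apply: (@continuous_max R _ (c i) (cst 0)); first exact: c_continuous.
  exact: cst_continuous.
exact: (cvgM cr cr).
Qed.

(** The sum is the derivative of [violation] at [y] along [v]. Squares are compared at
    [y + t_ k *: v] and [y] through [residual_sqr_le], then divided by [t_ k]. *)
Lemma violation_slope y eta : 0 < violation y -> 0 <= eta ->
  (forall u, violation y <= violation u + eta * `|u - y|) ->
  forall v, - (eta * `|v|) <=
    \sum_(i in A) residual i y / violation y * dotc (grad (c i) y) v.
Proof.
move=> y0 eta0 ymin v.
pose t_ k : R := k.+1%:R^-1.
have t_gt0 k : 0 < t_ k by rewrite invr_gt0.
pose D i k := (c i (y + t_ k *: v) - c i y) / t_ k.
have Dcvg i : (D i k @[k --> \oo] --> dotc (grad (c i) y) v)%classic.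
  apply: (first_order_cvg (w := fun=> v)) => //; first exact: cvg_harmonic.
    exact: cvg_cst.
  exact: (cC1 i).1.
(* By [residual_sqr_le], [t_ k * G k] bounds the increase of the squared violation from [y] to
   [y + t_ k *: v]. *)
pose G k := \sum_(i in A) (2 * (residual i y * D i k) + D i k * (D i k * t_ k)).
have Gcvg : (G k @[k --> \oo] -->
    \sum_(i in A) 2 * (residual i y * dotc (grad (c i) y) v))%classic.
  apply: cvg_sumr => i _; rewrite -[2 * _]addr0.
  apply: cvgD.
    apply: cvgM; first exact: cvg_cst.
    by apply: cvgM; [exact: cvg_cst|exact: Dcvg].
  pose a := dotc (grad (c i) y) v; rewrite -(mulr0 a) -[X in a * X](mulr0 a).
  apply: cvgM; first exact: Dcvg.
  by apply: cvgM; [exact: Dcvg|exact: cvg_harmonic].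
have Gge k : - (2 * (violation y * (eta * `|v|))) <= G k.
  have H1 : violation (y + t_ k *: v) ^+ 2 <= violation y ^+ 2 + t_ k * G k.
    rewrite !violation_sqr /G mulr_sumr -big_split/=; apply: ler_sum => i _.
    apply: le_trans (residual_sqr_le i _ y) _.
    rewrite -addrA lerD2l /D le_eqVlt; apply/orP; left; apply/eqP; field.
    by rewrite gt_eqF.
  have yv : y + t_ k *: v - y = t_ k *: v by rewrite [y + _]addrC addrK.
  have := ymin (y + t_ k *: v); rewrite yv normrZ gtr0_norm// mulrCA => H2.
  have a0 : 0 <= eta * `|v| by rewrite mulr_ge0.
  have b0 := violation_ge0 (y + t_ k *: v).
  have : t_ k * - (2 * (violation y * (eta * `|v|))) <= t_ k * G k.
    move: H1 H2 a0 b0 y0 (t_gt0 k).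
    set V := violation _; set W := violation y; set a := eta * _; set T := t_ k.
    move=> H1 H2 a0 b0 W0 T0.
    have Ta : 0 <= T * a by rewrite mulr_ge0// ltW.
    suff : W ^+ 2 <= V ^+ 2 + 2 * (T * a) * W by lra.
    move: Ta H2; set b := T * a => Ta H2.
    (* If b <= W, both sides of W - b <= V are nonnegative and may be squared; otherwise W^2 <= b
       W. *)
    have [bW|/ltW bW] := leP b W; last by nra.
    have : 0 <= (V - (W - b)) * (V + (W - b)) by rewrite mulr_ge0; lra.
    by have := sqr_ge0 b; nra.
  by rewrite ler_pM2l.
have := cvgr_to_ge Gcvg (nearW _ Gge).
set X := \sum_(i in A) _ => H.
have -> : \sum_(i in A) residual i y / violation y * dotc (grad (c i) y) v =
   X / (2 * violation y).
  by rewrite /X mulr_suml; apply: eq_bigr => i _; field; rewrite gt_eqF.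
rewrite ler_pdivlMr ?mulr_gt0//; apply: le_trans (H _ _).
by rewrite le_eqVlt; apply/orP; left; apply/eqP; ring.
Qed.

(** Failure of subregularity with constant (k+1)^2 gives [x = z + t *: w] farther than (k+1)^2
    [violation x] from every satisfied point. Ekeland's principle with slope 1/(k+1) moves [x] by at
    most (k+1) [violation x]. The spare factor k+1 keeps the new point unsatisfied and, since [z]
    itself is satisfied, makes the move at most t (|d|+1)/(k+1), so the direction still tends to
    [d]. *)
Lemma violating_point z d k (h := k.+1%:R^-1 : R) : satisfied z ->
  ~ dirnear z d (fun x => exists2 y, satisfied y &
      `|y - x| <= k.+1%:R ^+ 2 * violation x) ->
  exists tw : R * 'cV[R]_n, [/\ 0 < tw.1 < h, `|d - tw.2| <= (`|d| + 2) * h,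
    0 < violation (z + tw.1 *: tw.2) &
    forall u, violation (z + tw.1 *: tw.2) <=
      violation u + h * `|u - (z + tw.1 *: tw.2)|].
Proof.
move=> zs nH; have h0 : 0 < h by rewrite invr_gt0.
have h1 : h <= 1 by rewrite invf_le1// ler1n.
have [t [w [t0 th wh nex]]] : exists t w, [/\ 0 < t, t < h, `|d - w| < h &
    forall y, satisfied y ->
    k.+1%:R ^+ 2 * violation (z + t *: w) < `|y - (z + t *: w)|].
  apply: contrapT => nex; apply: nH => t_ w_ t_gt0 t0 wd.
  move/cvgrPdist_lt : t0 => /(_ h h0) tj.
  move/cvgrPdist_lt : wd => /(_ h h0) wj.
  apply: filterS2 tj wj => j tj wj; apply: contrapT => nP; apply: nex.
  exists (t_ j), (w_ j); split=> //.
    by rewrite sub0r normrN gtr0_norm in tj.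
  by move=> y ys; rewrite ltNge; apply/negP => yx; apply: nP; exists y.
set x := z + t *: w in nex.
have [y yx ymin] := ekeland x violation_continuous violation_ge0 h0.
have k1 : 1 <= k.+1%:R :> R by rewrite ler1n.
have hk : h * k.+1%:R = 1 by rewrite mulVf// pnatr_eq0.
have vx0 := violation_ge0 x; have vy0 := violation_ge0 y.
have yx' : `|y - x| <= k.+1%:R * violation x.
  have : h * `|y - x| <= h * (k.+1%:R * violation x).
    by rewrite mulrA hk mul1r; lra.
  by rewrite ler_pM2l.
have y_gt0 : 0 < violation y.
  rewrite lt_neqAle vy0 andbT eq_sym; apply/eqP => /violation0_satisfied /nex.
  by rewrite ltNge (le_trans yx')// expr2 ler_wpM2r// ler_peMr//
    (le_trans ler01).
have wd1 : `|w| <= `|d| + 1.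
  rewrite -[w](subrK d) addrC (le_trans (ler_normD _ _))// lerD2l distrC.
  by rewrite (le_trans (ltW wh)).
have ywt : `|y - x| <= t * (h * (`|d| + 1)).
  have zx : `|z - x| = t * `|w|.
    by rewrite /x opprD addrA subrr sub0r normrN normrZ gtr0_norm.
  have := nex _ zs; rewrite zx => /ltW H.
  have {}H : k.+1%:R * `|y - x| <= t * (`|d| + 1).
    apply: (le_trans (y := k.+1%:R * (k.+1%:R * violation x))).
      by rewrite ler_pM2l// (lt_le_trans ltr01).
    by rewrite mulrA -expr2 (le_trans H)// ler_pM2l.
  have : k.+1%:R * `|y - x| <= k.+1%:R * (t * (h * (`|d| + 1))).
    suff -> : k.+1%:R * (t * (h * (`|d| + 1))) = t * (`|d| + 1) by [].
    by rewrite mulrCA [k.+1%:R * _]mulrA [k.+1%:R * h]mulrC hk mul1r.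
  by rewrite ler_pM2l//.
have zy : z + t *: (t^-1 *: (y - z)) = y.
  by rewrite scalerA divff ?gt_eqF// scale1r addrC subrK.
exists (t, t^-1 *: (y - z)); rewrite /= zy; split=> //; first by rewrite t0.
have -> : d - t^-1 *: (y - z) = (d - w) - t^-1 *: (y - x).
  rewrite /x !scalerBr scalerDr scalerA mulVf ?gt_eqF// scale1r.
  by apply/matrixP => i j; rewrite !mxE; ring.
rewrite (le_trans (ler_normB _ _))// normrZ gtr0_norm ?invr_gt0//.
have : t^-1 * `|y - x| <= h * (`|d| + 1) by rewrite ler_pdivrMl.
by move: (ltW wh); lra.
Qed.

(** The residuals at the points of [violating_point], divided by the violation, form unit vectors; a
    limit [lam] is nonzero. Passing to the limit in [violation_slope] shows that [lam] annihilates
    the gradients, and where [lam i] is nonzero the residual eventually has its sign, so [lam]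
    contradicts quasi-normality. *)
Lemma quasi_normal_subregular z d : satisfied z -> quasi_normal z d ->
  exists kappa : R, dirnear z d (fun x => exists2 y, satisfied y &
    `|y - x| <= kappa * violation x).
Proof.
move=> zs QN; apply: contrapT => nH; apply: QN.
have /choice[tw Htw] : forall k, exists tw : R * 'cV[R]_n, _ :=
  fun k => violating_point zs (fun H => nH (ex_intro _ (k.+1%:R ^+ 2) H)).
pose t_ k := (tw k).1; pose w_ k := (tw k).2; pose y_ k := z + t_ k *: w_ k.
pose la k i := if i \in A then residual i (y_ k) / violation (y_ k) else 0.
pose u k : 'cV[R]_#|I| := \col_j la k (enum_val j).
have vy k : 0 < violation (y_ k) by have [] := Htw k.
have la1 k i : `|la k i| <= 1.
  rewrite /la; case: ifP => iA; last by rewrite normr0.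
  rewrite normrM normfV (gtr0_norm (vy k)) ler_pdivrMr// mul1r.
  exact: residual_le_violation.
have [s [l [sk ul]]] : exists (s : nat -> nat) (l : 'cV[R]_#|I|),
    (forall k, (k <= s k)%N) /\ (u \o s @ \oo --> l)%classic.
  apply: (@bounded_subseq _ _ u 1) => k.
  by apply: ler_mx_norm => // i j; rewrite mxE.
pose lam i := l (enum_rank i) 0.
have lacvg i : (la (s k) i @[k --> \oo] --> lam i)%classic.
  have -> : (fun k => la (s k) i) = fun k => (u \o s) k (enum_rank i) 0.
    by apply/funext => k; rewrite /= mxE enum_rankK.
  exact: mx_cvg_entry.
have hs (N k : nat) : ((s (N + k)%N).+1%:R^-1 : R) <= k.+1%:R^-1.
  by rewrite lef_pV2 ?posrE// ler_nat ltnS (leq_trans _ (sk _))// leq_addl.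
have tcvg N : (t_ (s (N + k)%N) @[k --> \oo] --> (0 : R))%classic.
  apply: (cvg_harmonic_bound (C := 1)) => k; rewrite mul1r sub0r normrN.
  have [/andP[t0 th] _ _ _] := Htw (s (N + k)%N).
  by rewrite gtr0_norm// (le_trans (ltW th)).
have wcvg N : (w_ (s (N + k)%N) @[k --> \oo] --> d)%classic.
  apply: (cvg_harmonic_bound (C := `|d| + 2)) => k.
  have [_ wd _ _] := Htw (s (N + k)%N); apply: (le_trans wd).
  by rewrite ler_wpM2l// addr_ge0.
have ycvg : (y_ (s k) @[k --> \oo] --> z)%classic.
  by apply: direction_point_cvg; [exact: (tcvg 0%N)|exact: (wcvg 0%N)].
have gcvg i : (grad (c i) (y_ (s k)) @[k --> \oo] --> grad (c i) z)%classic.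
  by apply: (cvg_comp _ _ ycvg); exact: (cC1 i).2.
have lam_ge0 v : 0 <= \sum_(i in A) lam i * dotc (grad (c i) z) v.
  have H1 : (\sum_(i in A) la (s k) i * dotc (grad (c i) (y_ (s k))) v +
      k.+1%:R^-1 * `|v| @[k --> \oo] -->
      \sum_(i in A) lam i * dotc (grad (c i) z) v + 0 * `|v|)%classic.
    apply: cvgD; last by apply: cvgM; [exact: cvg_harmonic|exact: cvg_cst].
    apply: cvg_sumr => i _; apply: cvgM; first exact: lacvg.
    by apply: dotc_cvg => //; exact: cvg_cst.
  rewrite mul0r addr0 in H1; apply: (cvgr_to_ge H1); apply: nearW => k.
  have [_ _ _ ymin] := Htw (s k).
  rewrite -lerBlDr sub0r.
  apply: (le_trans (y := - ((s k).+1%:R^-1 * `|v|))).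
    by rewrite lerN2 ler_wpM2r//; exact: (hs 0%N).
  rewrite (eq_bigr (fun i => residual i (y_ (s k)) / violation (y_ (s k)) *
    dotc (grad (c i) (y_ (s k))) v)); last by move=> i iA; rewrite /la iA.
  by apply: violation_slope => //; exact: vy.
have lam_norm : \sum_(i in A) lam i ^+ 2 = 1.
  have H1 : (\sum_(i in A) la (s k) i * la (s k) i @[k --> \oo] -->
      \sum_(i in A) lam i * lam i)%classic.
    by apply: cvg_sumr => i _; apply: cvgM; exact: lacvg.
  have H2 k : \sum_(i in A) la (s k) i * la (s k) i = 1.
    rewrite (eq_bigr (fun i => residual i (y_ (s k)) ^+ 2 *
      (violation (y_ (s k)) ^+ 2)^-1)).
      by rewrite -mulr_suml -violation_sqr divff// expf_neq0// gt_eqF.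
    by move=> i iA; rewrite /la iA -expr2 expr_div_n.
  have := cvg_lim (@Rhausdorff R) H1; under eq_fun do rewrite H2.
  rewrite lim_cst//= => ->; by apply: eq_bigr => i _; rewrite expr2.
exists lam; split.
- apply/not_existsP => lam0; have := lam_norm; rewrite big1.
    by move/esym/eqP; rewrite oner_eq0.
  by move=> i _; apply/eqP; rewrite sqrf_eq0; apply/negPn/negP; exact: lam0.
- split=> i iA.
    have := cvg_lim (@Rhausdorff R) (lacvg i).
    by rewrite /la (negPf iA) lim_cst// => <-.
  apply: (cvgr_to_ge (lacvg i)); apply: nearW => k; rewrite /la.
  case: ifP => // _; rewrite divr_ge0 ?violation_ge0//.
  by rewrite /residual (negPf iA) le_max lexx orbT.
- apply: dotc_inj_forall => v; apply/eqP; rewrite dotc_suml.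
  under eq_bigr do rewrite dotcZl.
  rewrite eq_le lam_ge0 andbT -oppr_ge0 -sumrN.
  have := lam_ge0 (- v); under eq_bigr do rewrite dotcNr mulrN.
  by [].
(* The sequences are shifted by [N], because quasi-normality asks for the signs at every index. *)
have [N _ HN] : \forall k \near \oo%classic, forall i, lam i != 0 ->
    0 < lam i * la (s k) i.
  apply: filter_forall => i; have [li|li] := eqVneq (lam i) 0.
    exact: nearW.
  have H1 : (lam i * la (s k) i @[k --> \oo] --> lam i * lam i)%classic.
    by apply: cvgM; [exact: cvg_cst|exact: lacvg].
  have := cvgr_gt _ H1 0; rewrite -expr2 exprn_even_gt0//= => /(_ _ li).
  by apply: filterS => k.
exists (fun k => t_ (s (N + k)%N)), (fun k => w_ (s (N + k)%N)); split=> //.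
  by move=> k; have [/andP[]] := Htw (s (N + k)%N).
move=> k i li; have := HN (N + k)%N (leq_addr _ _) i li.
rewrite -/(y_ _) /la; case: ifP => [iA|]; last by rewrite mulr0 ltxx.
set y := y_ _; have vy' : 0 < violation y by exact: vy.
rewrite mulrA pmulr_lgt0 ?invr_gt0// => H.
have r0 : residual i y != 0 by apply: contraTneq H => ->; rewrite mulr0 ltxx.
(* Since [residual * c] is the square of the residual, the sign passes from the residual to the
   constraint value. *)
have : 0 < (lam i * residual i y) * (residual i y * c i y).
  by rewrite mulr_gt0// residual_mul exprn_even_gt0.
have -> : lam i * residual i y * (residual i y * c i y) =
  lam i * c i y * residual i y ^+ 2 by ring.
by rewrite pmulr_lgt0// exprn_even_gt0.
Qed.

(** The version with a radius is needed for fixed directions close to [d], which do not converge to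
    [d]. *)
Lemma dirnear_ball z d (Q : 'cV[R]_n -> Prop) : dirnear z d Q ->
  exists2 e : R, 0 < e &
    forall t w, 0 < t < e -> `|w - d| < e -> Q (z + t *: w).
Proof.
move=> zQ; apply: contrapT => nH.
have /choice[tw Htw] : forall k : nat, exists tw : R * 'cV[R]_n,
    [/\ 0 < tw.1 < k.+1%:R^-1, `|tw.2 - d| < k.+1%:R^-1 &
      ~ Q (z + tw.1 *: tw.2)].
  move=> k; apply: contrapT => nex; apply: nH.
  exists k.+1%:R^-1; first by rewrite invr_gt0.
  by move=> t w tk wk; apply: contrapT => nQ; apply: nex; exists (t, w).
have [||| N _ /(_ N (leqnn N))] := zQ (fun k => (tw k).1) (fun k => (tw k).2).
- by move=> k; have [/andP[]] := Htw k.
- apply: (cvg_harmonic_bound (C := 1)) => k; rewrite mul1r sub0r normrN.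
  by have [/andP[t0 /ltW]] := Htw k; rewrite gtr0_norm.
- apply: (cvg_harmonic_bound (C := 1)) => k; rewrite mul1r distrC ltW//.
  by have [] := Htw k.
by have [] := Htw N.
Qed.

(** * Exact penalty and multipliers of a directional minimizer *)

Variables (f : 'cV[R]_n -> R) (z d : 'cV[R]_n).
Hypothesis fC1 : C1 f.
Hypothesis cz : forall i, i \in A -> c i z = 0.
Hypothesis cd : forall i, i \in A -> dotc (grad (c i) z) d = 0.
Hypothesis fd : dotc (grad f z) d <= 0.
Hypothesis fmin : dirnear z d (fun x => satisfied x -> f z <= f x).
Hypothesis zQN : quasi_normal z d.

Lemma satisfied_center : satisfied z.
Proof. by move=> i iA; rewrite /residual cz//; case: ifP; rewrite ?maxxx. Qed.

(** Subregularity supplies a satisfied point [y] near [x]; if [L] is a Lipschitz constant of [f],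
    then f z <= f y <= f x + L kappa [violation x]. Minimality applies to [y] because the active
    gradients are orthogonal to [d]: the violation is o(t), so [y] still approaches [z] in direction
    [d]. *)
Lemma exact_penalty : exists2 M : R, 0 <= M &
  dirnear z d (fun x => f z <= f x + M * \sum_(i in A) `|residual i x|).
Proof.
have [kappa0 subreg0] := quasi_normal_subregular satisfied_center zQN.
pose kappa := `|kappa0|; have k0 : 0 <= kappa by exact: normr_ge0.
have [L [e [L0 e0 flip]]] := C1_lipschitz z fC1.
exists (L * kappa); first exact: mulr_ge0 (ltW L0) k0.
move=> t_ w_ t_gt0 t0 wd.
pose x_ k := z + t_ k *: w_ k.
have /choice[y_ Hy] : forall k, exists y,
    (exists2 y, satisfied y & `|y - x_ k| <= kappa0 * violation (x_ k)) ->
    satisfied y /\ `|y - x_ k| <= kappa * violation (x_ k).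
  move=> k; have [[y ys yx]|nex] :=
      pselect (exists2 y, satisfied y & `|y - x_ k| <= kappa0 * violation (x_ k)).
    exists y; split=> //; apply: (le_trans yx).
    by rewrite ler_wpM2r ?violation_ge0// ler_norm.
  by exists 0.
have subreg := subreg0 _ _ t_gt0 t0 wd.
have vcvg : (violation (x_ k) / t_ k @[k --> \oo] --> (0 : R))%classic.
  have S0 : ((\sum_(i in A) `|(c i (x_ k) - c i z) / t_ k|) @[k --> \oo] -->
      \sum_(i in A) `|dotc (grad (c i) z) d|)%classic.
    apply: cvg_sumr => i _; apply: cvg_norm; apply: first_order_cvg => //.
    exact: (cC1 i).1.
  rewrite big1 in S0; last by move=> i iA; rewrite cd// normr0.
  apply: (squeeze_cvgr _ (cvg_cst 0) S0); apply: nearW => k.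
  rewrite divr_ge0 ?violation_ge0 ?(ltW (t_gt0 _))//=.
  rewrite ler_pdivrMr// (le_trans (violation_le_sum _))// mulr_suml.
  apply: ler_sum => i iA; rewrite cz// subr0 normrM normfV.
  by rewrite (gtr0_norm (t_gt0 k)) mulfVK ?gt_eqF// residual_abs_le.
(* Falling back to [w_ k] where no such point is available defines the corrected directions at every
   index and keeps the limit [d]. *)
pose w' k := if pselect (satisfied (y_ k) /\
   `|y_ k - x_ k| <= kappa * violation (x_ k))
  then (t_ k)^-1 *: (y_ k - z) else w_ k.
have w'd : (w' @ \oo --> d)%classic.
  have D0 : (w' k - w_ k @[k --> \oo] --> (0 : 'cV[R]_n))%classic.
    have K0 : (kappa * (violation (x_ k) / t_ k) @[k --> \oo] -->
        (0 : R))%classic.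
      by rewrite -(mulr0 kappa); apply: cvgM => //; exact: cvg_cst.
    apply/cvgr0Pnorm_le => eps eps0.
    move/cvgr0Pnorm_le : K0 => /(_ eps eps0); apply: filterS => k K.
    apply: (le_trans _ K) => {K}.
    rewrite /w'; case: pselect => [H|H] /=; last first.
      by rewrite subrr normr0.
    have -> : (t_ k)^-1 *: (y_ k - z) - w_ k = (t_ k)^-1 *: (y_ k - x_ k).
      rewrite /x_ opprD addrA [in RHS]scalerBr scalerA mulVf ?gt_eqF//.
      by rewrite scale1r.
    rewrite normrZ normfV (gtr0_norm (t_gt0 k)).
    rewrite ger0_norm ?mulr_ge0 ?violation_ge0 ?invr_ge0 ?(ltW (t_gt0 k))//.
    by rewrite mulrA [leRHS]mulrC ler_pM2l ?invr_gt0//; case: H.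
  have := cvgD D0 wd; rewrite add0r => H.
  have -> : w' = fun k => w' k - w_ k + w_ k.
    by apply/funext => k; rewrite subrK.
  exact: H.
have xz : (x_ @ \oo --> z)%classic by exact: (direction_point_cvg t0 wd).
have yz : (z + t_ k *: w' k @[k --> \oo] --> z)%classic.
  exact: (direction_point_cvg t0 w'd).
have fy := fmin t_gt0 t0 w'd.
move/cvgrPdist_lt : xz => /(_ e e0) xz; move/cvgrPdist_lt : yz => /(_ e e0) yz.
near=> k.
have [ys yx] : satisfied (y_ k) /\ `|y_ k - x_ k| <= kappa * violation (x_ k).
  by apply: Hy; near: k; exact: subreg.
have yE : z + t_ k *: w' k = y_ k.
  rewrite /w'; case: pselect => [H|[]//] /=.
  by rewrite scalerA divff ?gt_eqF// scale1r addrC subrK.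
have fzy : f z <= f (y_ k).
  by rewrite -yE; move: (ys); rewrite -yE; near: k; exact: fy.
have xe : `|x_ k - z| < e by rewrite distrC; near: k; exact: xz.
have ye : `|y_ k - z| < e by rewrite distrC -yE; near: k; exact: yz.
have := flip _ _ ye xe => /(le_trans (ler_norm _)) fyx.
apply: (le_trans fzy); rewrite -lerBlDl; apply: (le_trans fyx).
rewrite -mulrA ler_pM2l//; apply: (le_trans yx).
by rewrite ler_wpM2l// violation_le_sum.
Unshelve. all: by end_near. Qed.

(** For M >= 0 this is M |s| on equalities and M times the positive part on inequalities, written as
    a maximum of two linear functions to suit [piecewise_linear_multiplier]. *)
Definition penalty (M : R) i (s : R) :=
  Num.max ((if i \in E then - M else 0) * s) (M * s).

Lemma penaltyE M i x : 0 <= M -> M * `|residual i x| = penalty M i (c i x).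
Proof.
move=> M0; rewrite /residual /penalty; case: ifP => _.
  have [c0|c0] := leP 0 (c i x).
    by rewrite ger0_norm// max_r//; apply: ler_wpM2r => //; lra.
  rewrite ltr0_norm// max_l; first by rewrite mulrN mulNr.
  by apply: ler_wnM2r; [exact: ltW|lra].
rewrite mul0r; have [c0|c0] := leP (c i x) 0.
  by rewrite normr0 mulr0 max_l// mulr_ge0_le0.
by rewrite gtr0_norm// max_r// mulr_ge0// ltW.
Qed.

Lemma penaltyZ M i a s : 0 <= a -> penalty M i (a * s) = a * penalty M i s.
Proof. by move=> a0; rewrite /penalty maxr_pMr// ![_ * (a * s)]mulrCA. Qed.

Lemma penalty_cvg M i (u : nat -> R) (a : R) : (u @ \oo --> a)%classic ->
  (penalty M i (u k) @[k --> \oo] --> penalty M i a)%classic.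
Proof.
move=> ua; have pen_cont : continuous (penalty M i).
  move=> s; set lo := if i \in E then - M else 0.
  have mc (b : R) : {for s, continuous ( *%R b : R -> R)}.
    by apply: (cvgM (F := nbhs s)); [exact: cvg_cst|exact: cvg_id].
  exact: (@continuous_max R R _ _ s (mc lo) (mc M)).
exact: (cvg_comp _ _ ua (pen_cont a)).
Qed.

Lemma penalty_multiplier M (q0 : R) (q : I -> R) : 0 <= M ->
  (forall v, 0 <= dotc (grad f z) v + q0 +
    \sum_(i in A) penalty M i (dotc (grad (c i) z) v + q i)) ->
  exists l : I -> R, [/\ multiplier_sign l,
    grad f z + \sum_(i in A) l i *: grad (c i) z = 0 &
    0 <= q0 + \sum_(i in A) l i * q i].
Proof.
move=> M0 H.
have [||l [lb l0 lq]] := @piecewise_linear_multiplier R n I (enum A) (grad f z) q0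
   (fun i => grad (c i) z) q (fun i => if i \in E then - M else 0) (fun=> M)
   (enum_uniq _).
- by move=> i /=; case: ifP => // _; lra.
- by move=> v; rewrite big_enum; exact: H.
exists (fun i => if i \in A then l i else 0); split.
- split=> i; first by move/negPf->.
  by move=> /negPf iE; case: ifP => // _; have := lb i; rewrite iE => /andP[].
- rewrite -[RHS]l0 big_enum; congr (_ + _).
  by apply: eq_bigr => i ->.
- rewrite big_enum in lq; apply: (le_trans lq); rewrite lerD2l.
  by rewrite le_eqVlt; apply/orP; left; apply/eqP/eq_bigr => i ->.
Qed.

Lemma exact_penaltyE : exists2 M : R, 0 <= M &
  dirnear z d (fun x => f z <= f x + \sum_(i in A) penalty M i (c i x)).
Proof.
have [M M0 EP] := exact_penalty; exists M => // t_ w_ tgt0 t0 wd.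
apply: filterS (EP _ _ tgt0 t0 wd) => k; rewrite mulr_sumr.
by under eq_bigr do rewrite penaltyE//.
Qed.

(** The penalised inequality is expanded along the fixed direction [d + s *: v]. The contributions
    of [d] vanish for the constraints and are nonpositive for [f], which leaves an inequality
    homogeneous in [v], ready to be dualised. *)
Lemma first_order_multiplier : exists l : I -> R, multiplier_sign l /\
  grad f z + \sum_(i in A) l i *: grad (c i) z = 0.
Proof.
have [M M0 /dirnear_ball[e e0 EP]] := exact_penaltyE.
have [|l [ls l0 _]] := @penalty_multiplier M 0 (fun=> 0) M0; last by exists l.
move=> v.
have v1 : 0 < `|v| + 1 by rewrite ltr_wpDl.
(* Small enough to keep [d + s *: v] within [e] of [d]; adding 1 covers [v = 0]. *)
pose s := e / 2 / (`|v| + 1).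
have s0 : 0 < s by rewrite !divr_gt0.
have sv : `|d + s *: v - d| < e.
  rewrite addrC addKr normrZ gtr0_norm//.
  apply: (le_lt_trans (y := s * (`|v| + 1))).
    by rewrite ler_pM2l// lerDl.
  by rewrite /s mulfVK ?gt_eqF//; lra.
pose t_ k : R := k.+1%:R^-1.
have tgt0 k : 0 < t_ k by rewrite invr_gt0.
have t0 : (t_ @ \oo --> (0 : R))%classic by exact: cvg_harmonic.
have wd : ((fun _ : nat => d + s *: v) @ \oo --> d + s *: v)%classic.
  exact: cvg_cst.
pose x_ k := z + t_ k *: (d + s *: v).
have Hk : \forall k \near \oo%classic, 0 <= (f (x_ k) - f z) / t_ k +
    \sum_(i in A) penalty M i ((c i (x_ k) - c i z) / t_ k).
  move/cvgrPdist_lt : t0 => /(_ e e0); apply: filterS => k.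
  rewrite sub0r normrN gtr0_norm// => te.
  have := EP (t_ k) (d + s *: v); rewrite tgt0 te => /(_ isT sv) H.
  have -> : \sum_(i in A) penalty M i ((c i (x_ k) - c i z) / t_ k) =
      (\sum_(i in A) penalty M i (c i (x_ k))) / t_ k.
    rewrite mulr_suml; apply: eq_bigr => i iA; rewrite cz// subr0.
    by rewrite mulrC penaltyZ ?invr_ge0 ?ltW// mulrC.
  by rewrite -mulrDl divr_ge0 ?(ltW (tgt0 k))//; move: H; rewrite /x_; lra.
have lim : ((f (x_ k) - f z) / t_ k + \sum_(i in A)
    penalty M i ((c i (x_ k) - c i z) / t_ k) @[k --> \oo] -->
    dotc (grad f z) (d + s *: v) +
    \sum_(i in A) penalty M i (dotc (grad (c i) z) (d + s *: v)))%classic.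
  apply: cvgD; first by apply: first_order_cvg => //; exact: fC1.1.
  apply: cvg_sumr => i _; apply: penalty_cvg.
  by apply: first_order_cvg => //; exact: (cC1 i).1.
have lim0 : 0 <= dotc (grad f z) (d + s *: v) +
    \sum_(i in A) penalty M i (dotc (grad (c i) z) (d + s *: v)).
  exact: (cvgr_to_ge lim Hk).
move: lim0; rewrite dotcDr dotcZr.
have -> : \sum_(i in A) penalty M i (dotc (grad (c i) z) (d + s *: v)) =
    s * \sum_(i in A) penalty M i (dotc (grad (c i) z) v + 0).
  rewrite mulr_sumr; apply: eq_bigr => i iA.
  by rewrite dotcDr cd// add0r dotcZr addr0 penaltyZ// ltW.
move=> H; rewrite addr0 -(pmulr_rge0 _ s0) mulrDr.
by move: H fd; lra.
Qed.

(** The expansion follows the parabolic arc z + t d + (t^2/2) v and is divided by t^2/2. The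
    singular terms in 2/t vanish for the constraints and are nonpositive for [f]; the Hessian forms
    become the constants [q0] and [q i] of the dualisation, so one multiplier serves all [v]. *)
Lemma second_order_multiplier : differentiable (grad f) z ->
  (forall i, differentiable (grad (c i)) z) ->
  exists l : I -> R, [/\ multiplier_sign l,
    grad f z + \sum_(i in A) l i *: grad (c i) z = 0 &
    0 <= quad (hess f z) d + \sum_(i in A) l i * quad (hess (c i) z) d].
Proof.
move=> df2 dc2; have [M M0 EP] := exact_penaltyE.
apply: (penalty_multiplier M0) => v.
pose t_ k : R := k.+1%:R^-1.
have tgt0 k : 0 < t_ k by rewrite invr_gt0.
have t0 : (t_ @ \oo --> (0 : R))%classic by exact: cvg_harmonic.
pose w_ k := d + (t_ k / 2) *: v.
have wd : (w_ @ \oo --> d)%classic.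
  have tv : ((t_ k / 2) *: v @[k --> \oo] --> (0 / 2 : R) *: v)%classic.
    apply: cvgZ; last exact: cvg_cst.
    by apply: cvgM; [exact: t0|exact: cvg_cst].
  by have := cvgD (cvg_cst d) tv; rewrite mul0r scale0r addr0 => H; exact: H.
pose x_ k := z + t_ k *: w_ k.
pose Q (phi : 'cV[R]_n -> R) k :=
  (phi (x_ k) - phi z - t_ k * dotc (grad phi z) (w_ k)) / (t_ k ^+ 2 / 2).
have QE phi k : (phi (x_ k) - phi z) / (t_ k ^+ 2 / 2) =
    dotc (grad phi z) d * (2 / t_ k) + (dotc (grad phi z) v + Q phi k).
  by rewrite /Q /w_ dotcDr dotcZr; field; rewrite gt_eqF.
have Hk : \forall k \near \oo%classic, 0 <= (dotc (grad f z) v + Q f k) +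
    \sum_(i in A) penalty M i (dotc (grad (c i) z) v + Q (c i) k).
  apply: filterS (EP _ _ tgt0 t0 wd) => k H.
  have t2 : 0 < (t_ k ^+ 2 / 2)^-1 by rewrite invr_gt0 divr_gt0 ?exprn_gt0.
  have -> : \sum_(i in A) penalty M i (dotc (grad (c i) z) v + Q (c i) k) =
      (\sum_(i in A) penalty M i (c i (x_ k))) / (t_ k ^+ 2 / 2).
    rewrite mulr_suml; apply: eq_bigr => i iA.
    have := QE (c i) k; rewrite cd// mul0r add0r cz// subr0 => <-.
    by rewrite mulrC penaltyZ ?(ltW t2)// mulrC.
  have : 0 <= (f (x_ k) - f z) / (t_ k ^+ 2 / 2) +
      (\sum_(i in A) penalty M i (c i (x_ k))) / (t_ k ^+ 2 / 2).
    by rewrite -mulrDl mulr_ge0 ?(ltW t2)//; move: H; rewrite -/(x_ k); lra.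
  rewrite QE; have : dotc (grad f z) d * (2 / t_ k) <= 0.
    by rewrite mulr_le0_ge0// divr_ge0 ?ltW.
  by lra.
have lim : ((dotc (grad f z) v + Q f k) + \sum_(i in A)
    penalty M i (dotc (grad (c i) z) v + Q (c i) k) @[k --> \oo] -->
    (dotc (grad f z) v + quad (hess f z) d) + \sum_(i in A)
    penalty M i (dotc (grad (c i) z) v + quad (hess (c i) z) d))%classic.
  apply: cvgD.
    apply: cvgD; first exact: cvg_cst.
    by apply: second_order_cvg => //; exact: fC1.1.
  apply: cvg_sumr => i _; apply: penalty_cvg; apply: cvgD; first exact: cvg_cst.
  by apply: second_order_cvg => //; exact: (cC1 i).1.
exact: (cvgr_to_ge lim Hk).
Qed.

End Program.

(** * Branches of a switching-constrained program *)

Lemma free_map_coef (K : fieldType) (V : vectType K) (J : eqType) (r : seq J)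
    (v : J -> V) (a : J -> K) : uniq r -> free (map v r) ->
  \sum_(j <- r) a j *: v j = 0 -> {in r, forall j, a j = 0}.
Proof.
elim: r => [//|j r IH] /= /andP[jr ur]; rewrite free_cons => /andP[vj fr].
rewrite big_cons => H.
have aj : a j = 0.
  apply: contraNeq vj => aj.
  have -> : v j = - (a j)^-1 *: \sum_(i <- r) a i *: v i.
    apply: (scalerI aj); rewrite scalerA mulrN divff// scaleN1r.
    by apply/eqP; rewrite -addr_eq0 H.
  rewrite memvZ// big_seq memv_suml// => i ir.
  by rewrite memvZ// memv_span// map_f.
move: H; rewrite aj scale0r add0r => /(IH ur fr) H i.
by rewrite inE => /orP[/eqP->//|/H].
Qed.

Section Switching.
Variables (R : realType) (n p q m : nat) (P : mpsc R n p q m).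
Implicit Types (z d x : 'cV[R]_n) (b : bool).

Notation J := ('I_p + 'I_q + ('I_m + 'I_m))%type.

(** Both components of a switch become separate constraints, and one finite index type covers all
    four families. *)
Definition con (i : J) : 'cV[R]_n -> R :=
  match i with
  | inl (inl i) => component (ineq P) i
  | inl (inr i) => component (eqc P) i
  | inr (inl i) => component (swG P) i
  | inr (inr i) => component (swH P) i
  end.

Definition equalities : {set J} :=
  [set i : J | if i is inl (inl _) then false else true].

(* The constraints active in direction [d] on the branch of the feasible set
   that resolves every fully degenerate switch by [G_i = 0] (if [b]) or by
   [H_i = 0] (otherwise). *)
Definition branch z d b : {set J} :=
  [set i : J | match i with
   | inl (inl i) => i \in Ig_dir P z d
   | inl (inr _) => true
   | inr (inl i) =>
       [|| i \in IG P z, i \in IG_dir P z d | b && (i \in IGH_dir P z d)]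
   | inr (inr i) =>
       [|| i \in IH P z, i \in IH_dir P z d | ~~ b && (i \in IGH_dir P z d)]
   end].

Definition mult_g (l : J -> R) : 'cV[R]_p := \col_i l (inl (inl i)).
Definition mult_h (l : J -> R) : 'cV[R]_q := \col_i l (inl (inr i)).
Definition mult_G (l : J -> R) : 'cV[R]_m := \col_i l (inr (inl i)).
Definition mult_H (l : J -> R) : 'cV[R]_m := \col_i l (inr (inr i)).

Lemma big_con (V : nmodType) (F : J -> V) : \sum_i F i =
  \sum_i F (inl (inl i)) + \sum_i F (inl (inr i)) +
  (\sum_i F (inr (inl i)) + \sum_i F (inr (inr i))).
Proof. by rewrite big_sumType/= big_sumType/= big_sumType. Qed.

Lemma lagrangianE lg lh lG lH (l : J -> R) :
  mult_g l = lg -> mult_h l = lh -> mult_G l = lG -> mult_H l = lH ->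
  lagrangian P lg lh lG lH = fun x => obj P x + \sum_i l i * con i x.
Proof.
move=> <- <- <- <-; apply/funext => x; rewrite big_con /lagrangian !addrA.
by congr (_ + _ + _ + _ + _); apply: eq_bigr => i _; rewrite mxE.
Qed.

Lemma jacT_mul k (F : 'cV[R]_n -> 'cV[R]_k) z (u : 'cV[R]_k) :
  (jac F z)^T *m u = \sum_i u i 0 *: grad (component F i) z.
Proof.
apply/colP => j; rewrite mxE summxE; apply: eq_bigr => i _.
by rewrite !mxE mulrC.
Qed.

Lemma sum_support (A : {set J}) (l : J -> R) (F : J -> 'cV[R]_n) :
  (forall i, i \notin A -> l i = 0) ->
  \sum_(i in A) l i *: F i = \sum_i l i *: F i.
Proof.
move=> lA; rewrite big_mkcond; apply: eq_bigr => i _.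
by case: ifP => // /negbT /lA ->; rewrite scale0r.
Qed.

Hypothesis P_C1 : C1_data P.

Lemma con_C1 i : C1 (con i).
Proof. by have [_ ? ? ? ?] := P_C1; case: i => [[i|i]|[i|i]] /=. Qed.

Lemma con_twice z i : twice_differentiable_data P z ->
  differentiable (grad (con i)) z.
Proof.
move=> [_ Hg Hh HG HH]; case: i => [[i|i]|[i|i]] /=.
- exact: (Hg i).2.
- exact: (Hh i).2.
- exact: (HG i).2.
- exact: (HH i).2.
Qed.

Lemma quad_lagrangian lg lh lG lH (l : J -> R) z d :
  mult_g l = lg -> mult_h l = lh -> mult_G l = lG -> mult_H l = lH ->
  twice_differentiable_data P z ->
  quad (hess (lagrangian P lg lh lG lH) z) d =
    quad (hess (obj P) z) d + \sum_i l i * quad (hess (con i) z) d.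
Proof.
move=> Eg Eh EG EH P2; rewrite (lagrangianE Eg Eh EG EH).
apply: (@quad_hess_comb R n J (obj P) con l z d).
- by have [[]] := P_C1.
- by move=> i; exact: (con_C1 i).1.
- by have [[]] := P2.
- by move=> i; exact: con_twice.
Qed.

(** * Feasibility, signs and quasi-normality of one branch *)

Section Branch.
Variables (z d : 'cV[R]_n) (b : bool).
Hypotheses (z_feasible : feasible P z) (d_lin : lin_cone P z d).

Lemma branch_active i : i \in branch z d b -> con i z = 0.
Proof.
have [_ h0 _] := z_feasible.
case: i => [[i|i]|[i|i]]; rewrite !inE /component //=.
- by move=> /andP[/eqP].
- by move=> _; exact: h0.
- by do ![case: eqP => //=]; rewrite ?andbF.
- by do ![case: eqP => //=]; rewrite ?andbF.
Qed.

Lemma branch_direction i : i \in branch z d b -> dotc (grad (con i) z) d = 0.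
Proof.
have [_ Dh DG DH _] := d_lin.
case: i => [[i|i]|[i|i]]; rewrite inE /=.
- by rewrite inE => /andP[_ /eqP].
- by move=> _; exact: Dh.
- move=> /or3P[iG|iG|/andP[_ iG]]; first exact: DG.
    by move: iG; rewrite inE => /and3P[_ /eqP].
  by move: iG; rewrite inE => /and3P[_ /eqP].
- move=> /or3P[iH|iH|/andP[_ iH]]; first exact: DH.
    by move: iH; rewrite inE => /and3P[_ _ /eqP].
  by move: iH; rewrite inE => /and3P[_ _ /eqP].
Qed.

(** Inequalities dropped from the branch are inactive or strictly decreasing along [d], hence
    negative near the limit. Every switch keeps at least one factor as an equality, by feasibility
    of [z] or, if both factors vanish at [z], by the product condition of the linearization cone. *)
Lemma branch_feasible : dirnear z d (fun x =>
  satisfied con (branch z d b) equalities x -> feasible P x).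
Proof.
have [g0 h0 GH0] := z_feasible; have [Dg Dh DG DH DGH] := d_lin.
move=> t_ w_ tgt0 t0 wd.
have xz : (z + t_ k *: w_ k @[k --> \oo] --> z)%classic.
  exact: (direction_point_cvg t0 wd).
have gnear : \forall k \near \oo%classic, forall i : 'I_p,
    i \notin Ig_dir P z d -> ineq P (z + t_ k *: w_ k) i 0 < 0.
  apply: filter_forall => i; have := con_C1 (inl (inl i)) => /= gC1.
  have [iI|iI] := boolP (i \in Ig_dir P z d); first exact: nearW.
  have [gi0|gi0] := eqVneq (ineq P z i 0) 0; last first.
    have gz : ineq P z i 0 < 0 by rewrite lt_neqAle gi0 g0.
    have gcvg : (component (ineq P) i (z + t_ k *: w_ k) @[k --> \oo] -->
        component (ineq P) i z)%classic.
      by exact: (cvg_comp _ _ xz (differentiable_continuous (gC1.1 z))).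
    have gk : \forall k \near \oo%classic,
        component (ineq P) i (z + t_ k *: w_ k) < 0 by exact: (cvgr_lt _ gcvg).
    by apply: filterS gk.
  have iIg : i \in Ig P z by rewrite inE gi0.
  have gd : dotc (gradg P z i) d < 0.
    by rewrite lt_neqAle Dg// andbT; move: iI; rewrite inE iIg.
  have gcvg : ((component (ineq P) i (z + t_ k *: w_ k) -
      component (ineq P) i z) / t_ k @[k --> \oo] -->
      dotc (gradg P z i) d)%classic.
    exact: (first_order_cvg t0 tgt0 wd (gC1.1 z)).
  have gk : \forall k \near \oo%classic, (component (ineq P) i (z + t_ k *: w_ k)
      - component (ineq P) i z) / t_ k < 0 by exact: (cvgr_lt _ gcvg).
  apply: filterS gk => k + _.
  by rewrite /component gi0 subr0 pmulr_llt0 ?invr_gt0.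
apply: filterS gnear => k gk xs; set x := z + _ in gk xs *.
have eqs i : i \in branch z d b -> i \in equalities -> con i x = 0.
  by move=> iA iE; have := xs i iA; rewrite /residual iE.
split.
- move=> i; have [iI|iI] := boolP (i \in Ig_dir P z d); last exact/ltW/gk.
  have iA : inl (inl i) \in branch z d b by rewrite inE.
  by have /eqP := xs _ iA; rewrite /residual inE /= eq_maxr.
- by move=> i; have := eqs (inl (inr i)); rewrite !inE; exact.
- move=> i.
  have GE : inr (inl i) \in branch z d b -> swG P x i 0 = 0.
    by move=> iA; apply: (eqs (inr (inl i)) iA); rewrite inE.
  have HE : inr (inr i) \in branch z d b -> swH P x i 0 = 0.
    by move=> iA; apply: (eqs (inr (inr i)) iA); rewrite inE.
  have [G0|G0] := eqVneq (swG P z i 0) 0; last first.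
    have H0 : swH P z i 0 = 0.
      by apply/eqP; have /eqP := GH0 i; rewrite mulf_eq0 (negPf G0).
    by rewrite HE ?mulr0// !inE H0 G0 eqxx.
  have [H0|H0] := eqVneq (swH P z i 0) 0; last first.
    by rewrite GE ?mul0r// !inE G0 H0 eqxx.
  have iGH : i \in IGH P z by rewrite inE G0 H0 eqxx.
  move: GE HE; have /eqP := DGH i iGH; rewrite !inE G0 H0 eqxx /= mulf_eq0.
  by move: (dotc (gradG P z i) d == 0) (dotc (gradH P z i) d == 0) b
    => [] [] [] //= _ GE HE; by [rewrite GE ?mul0r|rewrite HE ?mulr0].
Qed.

Lemma branch_local_min : local_minimizer P z -> dirnear z d (fun x =>
  satisfied con (branch z d b) equalities x -> obj P z <= obj P x).
Proof.
move=> [_ zmin] t_ w_ tgt0 t0 wd.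
have xz : (z + t_ k *: w_ k @[k --> \oo] --> z)%classic.
  exact: (direction_point_cvg t0 wd).
have zk : \forall k \near \oo%classic, feasible P (z + t_ k *: w_ k) ->
    obj P z <= obj P (z + t_ k *: w_ k) by exact: (xz _ zmin).
have fk := branch_feasible tgt0 t0 wd.
by apply: filterS2 zk fk => k H1 H2 /H2 /H1.
Qed.

(** On a fully degenerate switch the branch drops one of the two components, so its multiplier is
    zero; this yields the complementarity of M-multipliers. *)
Lemma branch_sign l : multiplier_sign (branch z d b) equalities l ->
  multiplier_signs P z d (mult_g l) (mult_G l) (mult_H l) /\
  (forall i, i \in IGH_dir P z d -> (if b then mult_H l else mult_G l) i 0 = 0).
Proof.
move=> [l0 l_ge0]; split; first split.
- by move=> i _; rewrite mxE; apply: l_ge0; rewrite inE.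
- by move=> i iI; rewrite mxE; apply: l0; rewrite inE.
- move=> i; rewrite mxE => iI; apply: l0; move: iI; rewrite !inE.
  by move: (swG P z i 0 == 0) (swH P z i 0 == 0) (dotc (gradG P z i) d == 0)
    (dotc (gradH P z i) d == 0) => [] [] [] [] //=; rewrite ?andbF.
- move=> i; rewrite mxE => iI; apply: l0; move: iI; rewrite !inE.
  by move: (swG P z i 0 == 0) (swH P z i 0 == 0) (dotc (gradG P z i) d == 0)
    (dotc (gradH P z i) d == 0) => [] [] [] [] //=; rewrite ?andbF.
move=> i iI; case: b l0 => l0; rewrite mxE; apply: l0; move: iI; rewrite !inE;
  by move: (swG P z i 0 == 0) (swH P z i 0 == 0) (dotc (gradG P z i) d == 0)
    (dotc (gradH P z i) d == 0) => [] [] [] [].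
Qed.

Lemma branch_quasi_normal : quasi_normal_dir P z d ->
  quasi_normal con (branch z d b) equalities z d.
Proof.
move=> QN [l [[i0 li0] ls l0 [t_ [w_ [tgt0 t0 wd lc]]]]]; apply: QN.
have [signs GH] := branch_sign ls.
exists (mult_g l), (mult_h l), (mult_G l), (mult_H l); split=> //.
- apply: contraNneq li0 => -[]; case: i0 => [[i|i]|[i|i]].
  + by move=> /colP/(_ i); rewrite !mxE => ->.
  + by move=> _ /colP/(_ i); rewrite !mxE => ->.
  + by move=> _ _ /colP/(_ i); rewrite !mxE => ->.
  + by move=> _ _ _ /colP/(_ i); rewrite !mxE => ->.
- rewrite -l0 (sum_support _ ls.1) big_con !jacT_mul !addrA.
  by congr (_ + _ + _ + _); apply: eq_bigr => i _; rewrite mxE.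
- move=> i /GH; case: b => ->; rewrite ?mulr0 ?mul0r//.
exists w_, t_; split=> // k; split=> i; rewrite mxE.
- exact: (lc k (inl (inl i))).
- exact: (lc k (inl (inr i))).
- exact: (lc k (inr (inl i))).
- exact: (lc k (inr (inr i))).
Qed.

Lemma branch_dir_multiplier l : multiplier_sign (branch z d b) equalities l ->
  grad (obj P) z + \sum_(i in branch z d b) l i *: grad (con i) z = 0 ->
  dir_multiplier P z d (mult_g l) (mult_h l) (mult_G l) (mult_H l).
Proof.
move=> ls l0; split; last exact: (branch_sign ls).1.
apply/esym; rewrite -[RHS]l0 (sum_support _ ls.1) big_con big_split/= !addrA.
congr (_ + _ + _ + _ + _); last 3 first.
- by apply: eq_bigr => i _; rewrite mxE.
- by apply: eq_bigr => i _; rewrite mxE.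
- by apply: eq_bigr => i _; rewrite mxE.
rewrite big_mkcond/=; apply: eq_bigr => i _; rewrite mxE.
case: ifP => // /negbT iI; rewrite (ls.1 (inl (inl i))) ?scale0r//.
by rewrite inE.
Qed.

Lemma branch_M_multiplier l : multiplier_sign (branch z d b) equalities l ->
  grad (obj P) z + \sum_(i in branch z d b) l i *: grad (con i) z = 0 ->
  M_multiplier_dir P z d (mult_g l) (mult_h l) (mult_G l) (mult_H l).
Proof.
move=> ls l0; split; first exact: branch_dir_multiplier.
by move=> i /(branch_sign ls).2; case: b => ->; rewrite ?mulr0 ?mul0r.
Qed.

End Branch.

(** * Necessary conditions from the branches *)

Section Necessary.
Variables (z d : 'cV[R]_n).
Hypotheses (z_min : local_minimizer P z) (d_crit : critical_cone P z d).

Lemma branch_first_order b :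
  quasi_normal con (branch z d b) equalities z d ->
  exists l, multiplier_sign (branch z d b) equalities l /\
    grad (obj P) z + \sum_(i in branch z d b) l i *: grad (con i) z = 0.
Proof.
move=> QN; have [zf _] := z_min; have [dl fd] := d_crit.
apply: (@first_order_multiplier R n _ con (branch z d b) equalities con_C1
  (obj P) z d) => //.
- by have [] := P_C1.
- by move=> i; exact: branch_active.
- by move=> i; exact: branch_direction.
- exact: branch_local_min.
Qed.

Lemma branch_second_order b : twice_differentiable_data P z ->
  quasi_normal con (branch z d b) equalities z d ->
  exists l, [/\ multiplier_sign (branch z d b) equalities l,
    grad (obj P) z + \sum_(i in branch z d b) l i *: grad (con i) z = 0 &
    0 <= quad (hess (lagrangian P (mult_g l) (mult_h l) (mult_G l) (mult_H l)) z) d].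
Proof.
move=> P2 QN; have [zf _] := z_min; have [dl fd] := d_crit.
have [||||||||l [ls l0 lq]] := @second_order_multiplier R n _ con (branch z d b)
  equalities con_C1 (obj P) z d => //.
- by have [] := P_C1.
- by move=> i; exact: branch_active.
- by move=> i; exact: branch_direction.
- exact: branch_local_min.
- by have [[]] := P2.
- by move=> i; exact: con_twice.
exists l; split=> //.
rewrite (quad_lagrangian d (erefl _) (erefl _) (erefl _) (erefl _) P2).
apply: (le_trans lq); rewrite lerD2l le_eqVlt big_mkcond; apply/orP; left.
by apply/eqP/eq_bigr => i _; case: ifP => // /negbT /ls.1 ->; rewrite mul0r.
Qed.

(** The union of the two branches indexes exactly the gradients of [LICQ_dir]; [r] lists these
    indices in the same order, so freeness transfers directly. *)
Lemma LICQ_coef (l : J -> R) : LICQ_dir P z d ->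
  (forall i, i \notin branch z d true :|: branch z d false -> l i = 0) ->
  \sum_i l i *: grad (con i) z = 0 -> forall i, l i = 0.
Proof.
move=> licq l0 lsum.
pose hp (i : 'I_p) : J := inl (inl i); pose hq (i : 'I_q) : J := inl (inr i).
pose hG (i : 'I_m) : J := inr (inl i); pose hH (i : 'I_m) : J := inr (inr i).
pose r : seq J := [seq hp i | i in Ig_dir P z d] ++ [seq hq i | i : 'I_q]
  ++ [seq hG i | i in IG P z :|: IG_dir P z d :|: IGH_dir P z d]
  ++ [seq hH i | i in IH P z :|: IH_dir P z d :|: IGH_dir P z d].
have imF (T : finType) (h : T -> J) (A : {pred T}) i : (forall j, h j != i) ->
    (i \in [seq h j | j in A]) = false.
  by move=> hi; apply/mapP => -[j _ ij]; have := hi j; rewrite ij eqxx.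
have rP i : (i \in r) = (i \in branch z d true :|: branch z d false).
  rewrite !mem_cat inE; case: i => [[i|i]|[i|i]].
  - rewrite (fintype.mem_image (f := hp)); last by move=> ? ? [].
    rewrite (imF _ hq)// (imF _ hG)// (imF _ hH)// !inE.
    by rewrite !orbF orbb.
  - rewrite (imF _ hp)// (fintype.mem_image (f := hq)); last by move=> ? ? [].
    by rewrite !inE.
  - rewrite (imF _ hp)// (imF _ hq)// (imF _ hH)// (fintype.mem_image (f := hG)).
      rewrite !inE; move: (swG P z i 0 == 0) (swH P z i 0 == 0).
      by move: (dotc (gradG P z i) d == 0) (dotc (gradH P z i) d == 0) => [] [] [] [].
    by move=> ? ? [].
  - rewrite (imF _ hp)// (imF _ hq)// (imF _ hG)// (fintype.mem_image (f := hH)).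
      rewrite !inE; move: (swG P z i 0 == 0) (swH P z i 0 == 0).
      by move: (dotc (gradG P z i) d == 0) (dotc (gradH P z i) d == 0) => [] [] [] [].
    by move=> ? ? [].
have fr : free [seq grad (con i) z | i <- r].
  by move: licq; rewrite /LICQ_dir /r !map_cat /image_mem -!map_comp.
have ur : uniq r by exact: map_uniq (free_uniq fr).
have r0 : \sum_(i <- r) l i *: grad (con i) z = 0.
  rewrite -[RHS]lsum big_uniq//= big_mkcond; apply: eq_bigr => i _.
  by case: ifP => // /negbT; rewrite rP => /l0 ->; rewrite scale0r.
have H := free_map_coef ur fr r0.
move=> i; have [ir|ir] := boolP (i \in r); first exact: H.
by apply: l0; rewrite -rP.
Qed.

Lemma LICQ_quasi_normal b : LICQ_dir P z d ->
  quasi_normal con (branch z d b) equalities z d.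
Proof.
move=> licq [l [[i0 /eqP +] ls lsum _]]; apply.
apply: LICQ_coef => //; last by rewrite -(sum_support _ ls.1).
move=> i; rewrite inE negb_or => /andP[H1 H2]; apply: ls.1.
by move: H1 H2; case: (b).
Qed.

(** The branch [b = true] has zero H-multipliers on the degenerate switches, the branch [b = false]
    zero G-multipliers. Their difference is a vanishing combination of the LICQ family, so both are
    the same multiplier. *)
Lemma LICQ_S_stationary : LICQ_dir P z d -> S_stationary_dir P z d.
Proof.
move=> licq.
have [l [ls l0]] := branch_first_order (LICQ_quasi_normal (b := true) licq).
have [k [ks k0]] := branch_first_order (LICQ_quasi_normal (b := false) licq).
have lk i : l i - k i = 0.
  apply: (LICQ_coef (l := fun i => l i - k i)) => // [j|].
    by rewrite inE negb_or => /andP[/ls.1 -> /ks.1 ->]; rewrite subrr.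
  under eq_bigr do rewrite scalerBl.
  rewrite sumrB -(sum_support _ ls.1) -(sum_support _ ks.1).
  apply/eqP; rewrite subr_eq0; apply/eqP; apply: (addrI (grad (obj P) z)).
  by rewrite l0 k0.
exists (mult_g l), (mult_h l), (mult_G l), (mult_H l).
have [_ lH] := branch_sign ls; have [_ kG] := branch_sign ks.
split; first exact: branch_dir_multiplier ls l0.
move=> i iI; split; last exact: lH.
have := kG i iI; rewrite !mxE => <-.
by apply/eqP; rewrite -subr_eq0 lk.
Qed.

End Necessary.

End Switching.

(** * Second-order sufficiency *)

Section Sufficient.
Variables (R : realType) (n p q m : nat) (P : mpsc R n p q m) (z : 'cV[R]_n).
Hypotheses (P_C1 : C1_data P) (z_feasible : feasible P z).

(** * Limit directions of feasible sequences *)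

Section FeasibleSequence.
Variables (d : 'cV[R]_n) (t_ : nat -> R) (w_ : nat -> 'cV[R]_n).
Hypotheses (tgt0 : forall k, 0 < t_ k) (t0 : (t_ @ \oo --> (0 : R))%classic).
Hypothesis wd : (w_ @ \oo --> d)%classic.
Let x_ k := z + t_ k *: w_ k.
Hypothesis x_feasible : forall k, feasible P (x_ k).

Lemma con_nonzero_near i : con P i z != 0 ->
  \forall k \near \oo%classic, con P i (x_ k) != 0.
Proof.
move=> ci0.
have xz : (x_ @ \oo --> z)%classic by exact: (direction_point_cvg t0 wd).
have cx : (con P i (x_ k) @[k --> \oo] --> con P i z)%classic.
  exact: (cvg_comp _ _ xz (differentiable_continuous ((con_C1 P_C1 i).1 z))).
have c0 : 0 < `|con P i z| by rewrite normr_gt0.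
move/cvgrPdist_lt : cx => /(_ _ c0); apply: filterS => k.
by apply: contraTneq => ->; rewrite subr0 ltxx.
Qed.

Lemma swG_near0 i : swH P z i 0 != 0 ->
  \forall k \near \oo%classic, swG P (x_ k) i 0 = 0.
Proof.
move=> /(con_nonzero_near (i := inr (inr i))); apply: filterS => k Hx.
have [_ _ /(_ i)/eqP] := x_feasible k.
by rewrite mulf_eq0 => /orP[/eqP//|]; move: Hx; rewrite /= /component => /negPf ->.
Qed.

Lemma swH_near0 i : swG P z i 0 != 0 ->
  \forall k \near \oo%classic, swH P (x_ k) i 0 = 0.
Proof.
move=> /(con_nonzero_near (i := inr (inl i))); apply: filterS => k Gx.
have [_ _ /(_ i)/eqP] := x_feasible k.
by rewrite mulf_eq0 => /orP[|/eqP//]; move: Gx; rewrite /= /component => /negPf ->.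
Qed.

Lemma con_slope_cvg i : ((con P i (x_ k) - con P i z) / t_ k @[k --> \oo] -->
  dotc (grad (con P i) z) d)%classic.
Proof. exact: (first_order_cvg t0 tgt0 wd ((con_C1 P_C1 i).1 z)). Qed.

Lemma con_constant_direction i : con P i z = 0 ->
  (\forall k \near \oo%classic, con P i (x_ k) = 0) ->
  dotc (grad (con P i) z) d = 0.
Proof.
move=> ci ck; have H0 : ((con P i (x_ k) - con P i z) / t_ k @[k --> \oo] --> (0 : R))%classic.
  apply: cvg_near_cst; apply: filterS ck => k ->.
  by rewrite ci subrr mul0r.
have <- := cvg_lim (@Rhausdorff R) H0.
by rewrite (cvg_lim (@Rhausdorff R) (@con_slope_cvg i)).
Qed.

(** Difference quotients pass to the limit. Near [z] a nonzero switch factor forces the other one to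
    vanish, and on doubly active switches the product of the two quotients is identically zero. *)
Lemma feasible_seq_lin_cone : lin_cone P z d.
Proof.
have [g0 h0 GH0] := z_feasible.
split=> i.
- rewrite inE => /eqP gi0.
  apply: (cvgr_to_le (@con_slope_cvg (inl (inl i)))); apply: nearW => k.
  have [gx _ _] := x_feasible k.
  by rewrite /= /component gi0 subr0 pmulr_lle0 ?invr_gt0.
- apply: (con_constant_direction (i := inl (inr i))); first exact: h0.
  by apply: nearW => k; have [_ hx _] := x_feasible k; exact: hx.
- rewrite inE => /andP[/eqP G0 H0].
  by apply: (con_constant_direction (i := inr (inl i))) => //; exact: swG_near0.
- rewrite inE => /andP[G0 /eqP H0].
  by apply: (con_constant_direction (i := inr (inr i))) => //; exact: swH_near0.
rewrite inE => /andP[/eqP G0 /eqP H0].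
have H : ((swG P (x_ k) i 0 - swG P z i 0) / t_ k *
    ((swH P (x_ k) i 0 - swH P z i 0) / t_ k) @[k --> \oo] -->
    dotc (gradG P z i) d * dotc (gradH P z i) d)%classic.
  exact: cvgM (@con_slope_cvg (inr (inl i))) (@con_slope_cvg (inr (inr i))).
have H1 : ((swG P (x_ k) i 0 - swG P z i 0) / t_ k *
    ((swH P (x_ k) i 0 - swH P z i 0) / t_ k) @[k --> \oo] --> (0 : R))%classic.
  apply: cvg_near_cst; apply: nearW => k; rewrite G0 H0 !subr0 mulrACA.
  by have [_ _ ->] := x_feasible k; rewrite mul0r.
by rewrite -(cvg_lim (@Rhausdorff R) H) (cvg_lim (@Rhausdorff R) H1).
Qed.

Hypothesis descent : forall k, obj P (x_ k) <= obj P z.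

Lemma descent_critical : critical_cone P z d.
Proof.
split; first exact: feasible_seq_lin_cone.
have fC1 : C1 (obj P) by have [] := P_C1.
apply: (cvgr_to_le (first_order_cvg t0 tgt0 wd (fC1.1 z))); apply: nearW => k.
by rewrite pmulr_lle0 ?invr_gt0// subr_le0; exact: descent.
Qed.

(** No constraint increases the Lagrangian along the sequence: doubly active switches carry zero
    multipliers, and on the others the only component with a possibly nonzero multiplier is
    eventually zero. *)
Lemma S_multiplier_near lg lh lG lH i : S_multiplier P z lg lh lG lH ->
  \forall k \near \oo%classic,
    (match i with inl (inl i) => lg i 0 | inl (inr i) => lh i 0
     | inr (inl i) => lG i 0 | inr (inr i) => lH i 0 end) *
      (con P i (x_ k) - con P i z) <= 0.
Proof.
have [g0 h0 GH0] := z_feasible.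
move=> [_ [lg0 lgN lGN lHN lGH]]; case: i => [[i|i]|[i|i]] /=; rewrite /component.
- have [iI|iI] := boolP (i \in Ig P z); last first.
    by apply: nearW => k; rewrite lgN// mul0r.
  apply: nearW => k; have [gx _ _] := x_feasible k.
  by move: (iI); rewrite inE => /eqP ->; rewrite subr0 mulr_ge0_le0// lg0.
- by apply: nearW => k; have [_ hx _] := x_feasible k; rewrite hx h0 subrr mulr0.
- have [H0|H0] := eqVneq (swH P z i 0) 0.
    apply: nearW => k; suff -> : lG i 0 = 0 by rewrite mul0r.
    have [G0|G0] := eqVneq (swG P z i 0) 0; last by rewrite lGN// inE G0 H0 eqxx.
    by have [] := lGH i; rewrite // inE G0 H0 eqxx.
  have G0 : swG P z i 0 = 0.
    by apply/eqP; have /eqP := GH0 i; rewrite mulf_eq0 (negPf H0) orbF.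
  by apply: filterS (swG_near0 H0) => k ->; rewrite G0 subrr mulr0.
- have [G0|G0] := eqVneq (swG P z i 0) 0.
    apply: nearW => k; suff -> : lH i 0 = 0 by rewrite mul0r.
    have [H0|H0] := eqVneq (swH P z i 0) 0; last by rewrite lHN// inE G0 H0 eqxx.
    by have [] := lGH i; rewrite // inE G0 H0 eqxx.
  have H0 : swH P z i 0 = 0.
    by apply/eqP; have /eqP := GH0 i; rewrite mulf_eq0 (negPf G0).
  by apply: filterS (swH_near0 G0) => k ->; rewrite H0 subrr mulr0.
Qed.

(** The Lagrangian does not increase from [z] to [x_ k], and stationarity cancels its linear term;
    dividing by t^2/2 leaves the Hessian form in the limit. *)
Lemma descent_S_multiplier lg lh lG lH : twice_differentiable_data P z ->
  S_multiplier P z lg lh lG lH ->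
  quad (hess (lagrangian P lg lh lG lH) z) d <= 0.
Proof.
move=> P2 Sl.
pose l (i : 'I_p + 'I_q + ('I_m + 'I_m)) :=
  match i with inl (inl i) => lg i 0 | inl (inr i) => lh i 0
  | inr (inl i) => lG i 0 | inr (inr i) => lH i 0 end.
have Eg : mult_g l = lg by apply/colP => i; rewrite mxE.
have Eh : mult_h l = lh by apply/colP => i; rewrite mxE.
have EG : mult_G l = lG by apply/colP => i; rewrite mxE.
have EH : mult_H l = lH by apply/colP => i; rewrite mxE.
rewrite (quad_lagrangian P_C1 d Eg Eh EG EH P2).
have l0 : grad (obj P) z + \sum_i l i *: grad (con P i) z = 0.
  have [Sl0 [_ lgN _ _ _]] := Sl.
  rewrite -[RHS]Sl0 big_con big_split/= !addrA; congr (_ + _ + _ + _ + _).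
  rewrite [RHS]big_mkcond; apply: eq_bigr => i _.
  by case: ifP => // /negbT /lgN ->; rewrite scale0r.
pose Q (phi : 'cV[R]_n -> R) k :=
  (phi (x_ k) - phi z - t_ k * dotc (grad phi z) (w_ k)) / (t_ k ^+ 2 / 2).
have lim : (Q (obj P) k + \sum_i l i * Q (con P i) k @[k --> \oo] -->
    quad (hess (obj P) z) d + \sum_i l i * quad (hess (con P i) z) d)%classic.
  apply: cvgD.
    by apply: second_order_cvg => //; [have [[]] := P_C1|have [[]] := P2].
  apply: cvg_sumr => i _; apply: cvgM; first exact: cvg_cst.
  apply: second_order_cvg => //; first exact: (con_C1 P_C1 i).1.
  exact: con_twice.
apply: (cvgr_to_le lim).
have near_le : \forall k \near \oo%classic, forall i,
    l i * (con P i (x_ k) - con P i z) <= 0.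
  by apply: filter_forall => i; have := S_multiplier_near i Sl.
apply: filterS near_le => k lk.
have -> : Q (obj P) k + \sum_i l i * Q (con P i) k =
    ((obj P (x_ k) - obj P z) + \sum_i l i * (con P i (x_ k) - con P i z) -
     t_ k * dotc (grad (obj P) z + \sum_i l i *: grad (con P i) z) (w_ k)) /
    (t_ k ^+ 2 / 2).
  rewrite dotcDl dotc_suml.
  have -> : \sum_i l i * Q (con P i) k =
      (\sum_i l i * (con P i (x_ k) - con P i z) -
       t_ k * \sum_i dotc (l i *: grad (con P i) z) (w_ k)) / (t_ k ^+ 2 / 2).
    rewrite mulr_sumr -sumrB mulr_suml; apply: eq_bigr => i _.
    by rewrite dotcZl /Q mulrA; congr (_ / _); ring.
  by rewrite /Q -mulrDl; congr (_ / _); ring.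
rewrite l0 dotc0l mulr0 subr0 mulr_le0_ge0//; last first.
  by rewrite invr_ge0 divr_ge0// exprn_ge0// ltW.
by rewrite -[leRHS]addr0 lerD// ?subr_le0 ?descent// sumr_le0.
Qed.

End FeasibleSequence.

Lemma S_multiplier_sufficient : twice_differentiable_data P z ->
  (forall d : 'cV[R]_n, d != 0 -> critical_cone P z d ->
     exists lg lh lG lH, S_multiplier P z lg lh lG lH /\
       0 < quad (hess (lagrangian P lg lh lG lH) z) d) ->
  strict_local_minimizer P z.
Proof.
move=> P2 H; split=> //; apply: contrapT => nmin.
have /choice[x_ Hx] : forall k : nat, exists x : 'cV[R]_n,
    [/\ `|x - z| < k.+1%:R^-1, x != z, feasible P x & obj P x <= obj P z].
  move=> k; apply: contrapT => nex; apply: nmin; apply/nbhs_ballP.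
  exists k.+1%:R^-1; first by rewrite /= invr_gt0.
  move=> x; rewrite -ball_normE /ball_ /= distrC => xz xf xnz.
  by rewrite ltNge; apply/negP => xle; apply: nex; exists x.
(* Normalisation by the distance makes the directions unit vectors, so their limit [d] is nonzero
   and the hypothesis applies to it. *)
pose t_ k := `|x_ k - z|; pose w_ k := (t_ k)^-1 *: (x_ k - z).
have tgt0 k : 0 < t_ k by rewrite normr_gt0 subr_eq0; have [] := Hx k.
have w1 k : `|w_ k| = 1.
  by rewrite normrZ normfV normr_id mulVf// gt_eqF//; exact: tgt0.
have [s [d [sk wd]]] : exists (s : nat -> nat) (d : 'cV[R]_n),
    (forall k, (k <= s k)%N) /\ (w_ \o s @ \oo --> d)%classic.
  by apply: (@bounded_subseq _ _ w_ 1) => k; rewrite w1.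
have t0 : (t_ \o s @ \oo --> (0 : R))%classic.
  apply: (cvg_harmonic_bound (C := 1)) => k; rewrite mul1r sub0r normrN normr_id.
  have [/ltW xk _ _ _] := Hx (s k); apply: (le_trans xk).
  by rewrite lef_pV2 ?posrE// ler_nat ltnS.
have d1 : `|d| = 1.
  have := cvg_lim (@Rhausdorff R) (cvg_norm wd) => <-.
  by under eq_fun do rewrite /= w1; rewrite lim_cst.
have xE k : z + (t_ \o s) k *: (w_ \o s) k = x_ (s k).
  by rewrite /= scalerA divff ?gt_eqF// scale1r addrC subrK.
have tsgt0 k : 0 < (t_ \o s) k by exact: tgt0.
have xf k : feasible P (z + (t_ \o s) k *: (w_ \o s) k).
  by rewrite xE; have [] := Hx (s k).
have xle k : obj P (z + (t_ \o s) k *: (w_ \o s) k) <= obj P z.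
  by rewrite xE; have [] := Hx (s k).
have d0 : d != 0 by rewrite -normr_eq0 d1 oner_eq0.
have [lg [lh [lG [lH [Sl]]]]] := H d d0 (descent_critical tsgt0 t0 wd xf xle).
by rewrite ltNge (descent_S_multiplier tsgt0 t0 wd xf xle P2 Sl).
Qed.

End Sufficient.

Theorem theorem4p2 (R : realType) (n p q m : nat) (P : mpsc R n p q m)
    (z : 'cV[R]_n) (P_C1 : C1_data P) :
  (local_minimizer P z ->
   forall d : 'cV[R]_n, critical_cone P z d ->
     (LICQ_dir P z d -> S_stationary_dir P z d) /\
     (quasi_normal_dir P z d ->
        M_stationary_dir P z d /\
        (twice_differentiable_data P z ->
         exists lg lh lG lH, M_multiplier_dir P z d lg lh lG lH /\
           0 <= quad (hess (lagrangian P lg lh lG lH) z) d)))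
  /\
  (feasible P z ->
   twice_differentiable_data P z ->
   (forall d : 'cV[R]_n, d != 0 -> critical_cone P z d ->
      exists lg lh lG lH, S_multiplier P z lg lh lG lH /\
        0 < quad (hess (lagrangian P lg lh lG lH) z) d) ->
   strict_local_minimizer P z).
Proof.
split=> [zmin d dcrit|zf P2 H]; last exact: S_multiplier_sufficient.
split; first exact: LICQ_S_stationary.
(* Either branch yields an M-multiplier; the one with G = 0 on degenerate switches is taken. *)
move=> QN; have QNb := branch_quasi_normal (b := true) QN; split=> [|P2].
  have [l [ls l0]] := branch_first_order P_C1 zmin dcrit QNb.
  exists (mult_g l), (mult_h l), (mult_G l), (mult_H l).
  exact: branch_M_multiplier ls l0.
have [l [ls l0 lq]] := branch_second_order P_C1 zmin dcrit P2 QNb.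
exists (mult_g l), (mult_h l), (mult_G l), (mult_H l); split=> //.
exact: branch_M_multiplier ls l0.
Qed.
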